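(* Let $d\ge3$, $\theta\in(0,\pi/2)$, $\lambda\in\Sigma_\theta$ and $x\ne0$ with $|\lambda||x|^2\le 1/2$. Then $$|\nabla_x\{\Gamma(x;\lambda)-\Gamma(x;0)\}|\le\begin{cases}C|\lambda||x|^{3-d}, & d=5 \text{ or } d\ge7,\\ C|\lambda||x|^{3-d}\,|\log(|\lambda||x|^2)|, & d=4\text{ or }6,\\ C\sqrt{|\lambda|}\,|x|^{-1}, & d=3,\end{cases}$$ where $C$ depends only on $d$ and $\theta$.
   Context: $\Sigma_\theta=\{z\in\mathbb{C}: z\neq0,\ |\arg z|<\pi-\theta\}$. For $\lambda=re^{i\tau}\in\Sigma_\theta$, $k=\sqrt r\,e^{i(\pi+\tau)/2}$; $G(x;\lambda)=\frac{i}{4(2\pi)^{(d-2)/2}}|x|^{2-d}(k|x|)^{\frac d2-1}H^{(1)}_{\frac d2-1}(k|x|)$ ($H^{(1)}_\nu$ the Hankel function of the first kind); $G(x;0)=\frac{1}{(d-2)\omega_d}|x|^{2-d}$, $\omega_d=|\mathbb{S}^{d-1}|$. $\Gamma_{\alpha\beta}(x;\lambda)=G(x;\lambda)\delta_{\alpha\beta}-\frac1\lambda\partial_\alpha\partial_\beta\{G(x;\lambda)-G(x;0)\}$, and $\Gamma(x;0)$ is the Stokes fundamental matrix for $\lambda=0$: $$\Gamma_{\alpha\beta}(x;0)=\frac{1}{2\omega_d}\Big\{\frac{\delta_{\alpha\beta}}{(d-2)|x|^{d-2}}+\frac{x_\alpha x_\beta}{|x|^d}\Big\}.$$ *)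

(* Defs.v *)
From Stdlib Require Import Reals Lra ZArith List ClassicalEpsilon.
Open Scope R_scope.

Definition C := (R * R)%type.
Definition Cre (z : C) : R := fst z.
Definition Cim (z : C) : R := snd z.
Definition RtoC (a : R) : C := (a, 0).
Definition Ci : C := (0, 1).
Definition Cadd (z w : C) : C := (Cre z + Cre w, Cim z + Cim w).
Definition Copp (z : C) : C := (- Cre z, - Cim z).
Definition Csub (z w : C) : C := Cadd z (Copp w).
Definition Cmul (z w : C) : C :=
  (Cre z * Cre w - Cim z * Cim w, Cre z * Cim w + Cim z * Cre w).
Definition Cscal (a : R) (z : C) : C := (a * Cre z, a * Cim z).
Definition Cmod (z : C) : R := sqrt (Cre z ^ 2 + Cim z ^ 2).
Definition Cinv (z : C) : C :=
  (Cre z / (Cre z ^ 2 + Cim z ^ 2), - Cim z / (Cre z ^ 2 + Cim z ^ 2)).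
Definition Cdiv (z w : C) : C := Cmul z (Cinv w).
Fixpoint Cpow (z : C) (n : nat) : C :=
  match n with O => RtoC 1 | S m => Cmul z (Cpow z m) end.
Definition Cexp (z : C) : C := (exp (Cre z) * cos (Cim z), exp (Cre z) * sin (Cim z)).
Definition Carg (z : C) : R :=
  if Rlt_dec 0 (Cim z) then acos (Cre z / Cmod z)
  else if Rlt_dec (Cim z) 0 then - acos (Cre z / Cmod z)
  else if Rle_dec 0 (Cre z) then 0 else PI.
Definition Clog (z : C) : C := (ln (Cmod z), Carg z).
Definition Cpowr (z : C) (a : R) : C :=
  if Req_EM_T (Cmod z) 0 then RtoC 0 else Cexp (Cscal a (Clog z)).
Definition Cseries (f : nat -> C) : C :=
  (epsilon (inhabits 0) (fun l => infinite_sum (fun n => Cre (f n)) l),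
   epsilon (inhabits 0) (fun l => infinite_sum (fun n => Cim (f n)) l)).
Definition Csum (f : nat -> C) (n : nat) : C :=
  fold_right Cadd (RtoC 0) (map f (seq 0 n)).

(* gh n = Gamma((n+1)/2) *)
Fixpoint gh (n : nat) : R :=
  match n with
  | O => sqrt PI
  | S O => 1
  | S (S m) => (INR m + 1) / 2 * gh m
  end.
(* rgn j = 1 / Gamma(1/2 - j) *)
Fixpoint rgn (j : nat) : R :=
  match j with
  | O => / sqrt PI
  | S i => (- INR i - 1/2) * rgn i
  end.
(* reciprocal Gamma at k/2, k : Z  (zero at the poles k = 0, -2, -4, ...) *)
Definition rgamma_half (k : Z) : R :=
  if Z.leb 1 k then / gh (Z.to_nat (k - 1))
  else if Z.even k then 0 else rgn (Z.to_nat ((1 - k) / 2)).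

Definition harmonic (n : nat) : R :=
  match n with O => 0 | S m => sum_f_R0 (fun k => / INR (S k)) m end.
Definition euler_gamma : R :=
  epsilon (inhabits 0) (fun g => Un_cv (fun n => harmonic n - ln (INR n)) g).
Definition digamma_succ (n : nat) : R := - euler_gamma + harmonic n.

Definition nu_of (s : Z) : R := IZR s / 2.

(* J_nu(z) = (z/2)^nu sum_m (-1)^m (z/2)^(2m) / (m! Gamma(m+nu+1)) *)
Definition BesselJ (s : Z) (z : C) : C :=
  let w := Cscal (/2) z in
  Cmul (Cpowr w (nu_of s))
    (Cseries (fun m => Cscal ((-1) ^ m / INR (fact m) * rgamma_half (2 * Z.of_nat m + s + 2))
                        (Cpow w (2 * m)))).

(* Y_n for integer order n >= 0 (Abramowitz-Stegun 9.1.11) *)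
Definition BesselY_int (n : nat) (z : C) : C :=
  let w := Cscal (/2) z in
  Cadd (Cadd
    (Cscal (- / PI) (Cmul (Cinv (Cpow w n))
        (Csum (fun k => Cscal (INR (fact (n - k - 1)) / INR (fact k)) (Cpow (Cmul w w) k)) n)))
    (Cscal (2 / PI) (Cmul (Clog w) (BesselJ (Z.of_nat (2 * n)) z))))
    (Cscal (- / PI) (Cmul (Cpow w n)
        (Cseries (fun k => Cscal ((digamma_succ k + digamma_succ (n + k))
                                   / (INR (fact k) * INR (fact (n + k))))
                             (Cpow (Copp (Cmul w w)) k))))).

Definition BesselY (s : Z) (z : C) : C :=
  if Z.even s then BesselY_int (Z.to_nat (s / 2)) z
  else Cscal (/ sin (nu_of s * PI))
         (Csub (Cscal (cos (nu_of s * PI)) (BesselJ s z)) (BesselJ (- s) z)).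

Definition Hankel1 (s : Z) (z : C) : C := Cadd (BesselJ s z) (Cmul Ci (BesselY s z)).

Definition Rsum (d : nat) (f : nat -> R) : R := fold_right Rplus 0 (map f (seq 0 d)).
Definition vnorm (d : nat) (x : nat -> R) : R := sqrt (Rsum d (fun i => x i ^ 2)).
Definition upd (x : nat -> R) (a : nat) (t : R) : nat -> R :=
  fun j => if Nat.eqb j a then t else x j.
Definition pdR (f : (nat -> R) -> R) (a : nat) (x : nat -> R) : R :=
  epsilon (inhabits 0) (fun l => derivable_pt_lim (fun t => f (upd x a t)) (x a) l).
Definition pdC (f : (nat -> R) -> C) (a : nat) (x : nat -> R) : C :=
  (pdR (fun y => Cre (f y)) a x, pdR (fun y => Cim (f y)) a x).
Definition kron (a b : nat) : R := if Nat.eqb a b then 1 else 0.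

Definition lam (r tau : R) : C := (r * cos tau, r * sin tau).
Definition kk (r tau : R) : C :=
  (sqrt r * cos ((PI + tau) / 2), sqrt r * sin ((PI + tau) / 2)).
(* omega_d = |S^{d-1}| = 2 pi^{d/2} / Gamma(d/2) *)
Definition omega (d : nat) : R := 2 * Rpower PI (INR d / 2) / gh (d - 1).

Definition Gl (d : nat) (r tau : R) (x : nat -> R) : C :=
  let rho := vnorm d x in
  let z := Cscal rho (kk r tau) in
  Cmul (Cscal (/ (4 * Rpower (2 * PI) ((INR d - 2) / 2)) * / rho ^ (d - 2)) Ci)
       (Cmul (Cpowr z (INR d / 2 - 1)) (Hankel1 (Z.of_nat d - 2) z)).
Definition G0 (d : nat) (x : nat -> R) : R :=
  / ((INR d - 2) * omega d) * / vnorm d x ^ (d - 2).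

Definition Gam (d : nat) (r tau : R) (a b : nat) (x : nat -> R) : C :=
  Csub (Cscal (kron a b) (Gl d r tau x))
       (Cmul (Cinv (lam r tau))
          (pdC (fun y => pdC (fun u => Csub (Gl d r tau u) (RtoC (G0 d u))) b y) a x)).
(* Gamma_{ab}(x; 0), the Stokes fundamental matrix *)
Definition Gam0 (d : nat) (a b : nat) (x : nat -> R) : R :=
  / (2 * omega d) * (kron a b / ((INR d - 2) * vnorm d x ^ (d - 2))
                     + x a * x b / vnorm d x ^ d).

Definition gradDiffNorm (d : nat) (r tau : R) (x : nat -> R) : R :=
  sqrt (Rsum d (fun a => Rsum d (fun b => Rsum d (fun c =>
     Cmod (pdC (fun y => Csub (Gam d r tau a b y) (RtoC (Gam0 d a b y))) c x) ^ 2)))).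

(* Main.v *)
(** By homogeneity [G(y; lambda)] is [r ^ nu] times a function of the single variable
    [t = r |y| ^ 2], with [nu = d / 2 - 1] and [r = |lambda|]; the series of the Bessel functions
    make that function [U t + V t * ln t + t ^ (- nu) * W t] with entire [U], [V], [W] whose
    coefficients are bounded uniformly in [arg lambda].  The coefficient [W 0] is the Laplace
    kernel, and [W 1] (or [V 0] when [d = 4]) produces the Stokes kernel, so that both cancel
    in [Gamma(y; lambda) - Gamma(y; 0)].  What remains of [G] and of [G / lambda], up to affine
    terms killed by the derivatives, is a sum of symbols, that is of functions whose
    derivatives grow as those of a power of [t], and this bounds the gradient
    by [C r |y| ^ (3 - d)] in every dimension.  This is at least as strong as each case of the
    claim; in particular no logarithm is needed for [d = 4] or [d = 6]. *)

From Coquelicot Require Import Rcomplements Rbar Hierarchy Continuity Derive Series PSeries ElemFct AutoDerive.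
From Stdlib Require Import Reals Lra Lia ZArith List ClassicalEpsilon FunctionalExtensionality.
Require Import Defs.
Open Scope R_scope.

(** * Symbols on the unit interval *)

(** The obstacle is the division by lambda: without the Laplace kernel, G is still of size t^(1 -
    nu), and this leading term of G / lambda must match the Stokes kernel exactly. The matching is
    scalar: with R0 = r^nu and p' = kappa t^(-nu), the Stokes kernel is delta_ab G0 - (1/r) d_a d_b
    (R0 p(r |y|^2)), so subtracting the one function p from the radial profile settles all entries.

    Dividing by lambda = r e^(i tau) rotates the coefficients by e^(-i tau). Since k^2 = -lambda,
    the rotated leading coefficient is real, as its cancellation against a real kernel requires; the
    phases have modulus one, whence the uniformity in tau.

    No logarithm survives because the gradient sees G only through one derivative in t, and G /
    lambda only through the second and third. At these orders each logarithm either has become a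
    pure power or comes with a spare power of t that absorbs it. Symbols therefore record the order
    from which their bounds hold. *)

Definition exp_bounded (M : R) (a : nat -> R) : Prop :=
  forall m, Rabs (a m) <= M / INR (fact m).

Lemma exp_bounded_nonneg M a : exp_bounded M a -> 0 <= M.
Proof.
intros H; generalize (H O) (Rabs_pos (a O)); simpl; lra.
Qed.

Lemma exp_bounded_const M a m : exp_bounded M a -> Rabs (a m) <= M.
Proof.
intros H.
generalize (H m) (exp_bounded_nonneg _ _ H) (INR_fact_lt_0 m); intros H1 H2 H3.
assert (1 <= INR (fact m)) by (apply (le_INR 1); apply lt_O_fact).
apply Rle_trans with (1 := H1).
apply Rmult_le_reg_r with (INR (fact m)); [lra|].
unfold Rdiv; rewrite Rmult_assoc, Rinv_l by lra; nra.
Qed.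

Lemma exp_bounded_decr M a : exp_bounded M a -> exp_bounded M (PS_decr_1 a).
Proof.
intros H m; unfold PS_decr_1.
apply Rle_trans with (1 := H (S m)).
apply Rmult_le_compat_l; [now apply exp_bounded_nonneg in H|].
apply Rinv_le_contravar; [apply INR_fact_lt_0|].
apply le_INR; simpl; lia.
Qed.

(** The factor m + 1 cancels against (m + 1)!, so [M] does not grow; this is why factorial bounds
    are carried instead of mere boundedness. *)
Lemma exp_bounded_derive M a : exp_bounded M a -> exp_bounded M (PS_derive a).
Proof.
intros H m; unfold PS_derive.
rewrite Rabs_mult, Rabs_pos_eq by apply pos_INR.
generalize (H (S m)) (INR_fact_lt_0 m) (lt_0_INR (S m) ltac:(lia)).
change (fact (S m)) with (S m * fact m)%nat; rewrite mult_INR; intros H1 H2 H3.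
apply Rle_trans with (INR (S m) * (M / (INR (S m) * INR (fact m)))).
- apply Rmult_le_compat_l; lra.
- right; field; lra.
Qed.

Lemma exp_bounded_radius M a t : exp_bounded M a -> 0 < t < 1 ->
  Rbar_lt (Rabs t) (CV_radius a).
Proof.
intros H Ht; rewrite Rabs_pos_eq by lra.
apply Rbar_lt_le_trans with 1; [simpl; lra|].
apply CV_radius_bounded; exists M; intros n.
rewrite pow1, Rmult_1_r; now apply exp_bounded_const.
Qed.

Lemma ex_exp_bounded M a t : exp_bounded M a -> 0 < t < 1 -> ex_pseries a t.
Proof.
intros H Ht; apply CV_radius_inside; now apply exp_bounded_radius with M.
Qed.

Lemma exp_bounded_PSeries M a t : exp_bounded M a -> 0 < t < 1 ->
  Rabs (PSeries a t) <= 3 * M.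
Proof.
intros H Ht.
assert (HM := exp_bounded_nonneg _ _ H).
assert (E : is_series (fun n => M * (/ INR (fact n) * t ^ n)) (M * exp t)).
{ exact (is_series_scal_l M _ _ (proj1 (is_pseries_R _ _ _) (is_exp_Reals t))). }
assert (L : forall n, 0 <= Rabs (a n * t ^ n) <= M * (/ INR (fact n) * t ^ n)).
{ intros n; split; [apply Rabs_pos|].
  rewrite Rabs_mult, (Rabs_pos_eq (t ^ n)), <- Rmult_assoc by (apply pow_le; lra).
  apply Rmult_le_compat_r; [apply pow_le; lra|apply H]. }
unfold PSeries; apply Rle_trans with (Series (fun n => Rabs (a n * t ^ n))).
- apply Series_Rabs.
  apply (CV_disk_inside a t); now apply exp_bounded_radius with M.
- apply Rle_trans with (Series (fun n => M * (/ INR (fact n) * t ^ n))).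
  + apply Series_le; [exact L|]; eexists; apply E.
  + rewrite (is_series_unique _ _ E).
    (* The 3 of the statement bounds e, uniformly up to t = 1. *)
    assert (exp t <= 3).
    { apply Rle_trans with (exp 1); [|apply exp_le_3].
      left; apply exp_increasing; lra. }
    nra.
Qed.

Lemma is_derive_prod (f g : R -> R) t a b :
  is_derive f t a -> is_derive g t b ->
  is_derive (fun x => f x * g x) t (a * g t + f t * b).
Proof.
intros Hf Hg; apply (is_derive_mult f g t a b Hf Hg); intros; apply Rmult_comm.
Qed.

Definition near_zero_bound (M p : R) (f : R -> R) : Prop :=
  forall t, 0 < t < 1 -> Rabs (f t) <= M * Rpower t p.

Definition derives (f g : R -> R) : Prop :=
  forall t, 0 < t < 1 -> is_derive f t (g t).

(* The derivatives of [f] of orders [j] to [3] are of the size that those of [t ^ p] have. *)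
Definition symb (j : nat) (M p : R) (f : R -> R) : Prop :=
  0 <= M /\ exists f1 f2 f3,
  (derives f f1 /\ derives f1 f2 /\ derives f2 f3) /\
  ((j <= 0)%nat -> near_zero_bound M p f) /\
  ((j <= 1)%nat -> near_zero_bound M (p - 1) f1) /\
  ((j <= 2)%nat -> near_zero_bound M (p - 2) f2) /\
  near_zero_bound M (p - 3) f3.

Ltac split_symb :=
  refine (conj (conj _ (conj _ _)) (conj _ (conj _ (conj _ _)))); intros.

Lemma locally_unit (P : R -> Prop) t :
  (forall s, 0 < s < 1 -> P s) -> 0 < t < 1 -> locally t P.
Proof.
intros H Ht.
assert (0 < Rmin t (1 - t)) as He by (apply Rmin_pos; lra).
exists (mkposreal _ He); intros s Hs.
assert (Hs' : Rabs (s - t) < Rmin t (1 - t)) by exact Hs.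
apply H; apply Rabs_def2 in Hs'.
generalize (Rmin_l t (1 - t)) (Rmin_r t (1 - t)); lra.
Qed.

Lemma derives_ext f f' g : (forall t, 0 < t < 1 -> f t = f' t) ->
  derives f g -> derives f' g.
Proof.
intros E H t Ht.
apply is_derive_ext_loc with f; [|now apply H].
now apply locally_unit.
Qed.

Lemma symb_ext j M p f g : (forall t, 0 < t < 1 -> f t = g t) ->
  symb j M p f -> symb j M p g.
Proof.
intros E (HM & f1 & f2 & f3 & (D1 & D2 & D3) & B0 & B1 & B2 & B3).
split; [exact HM|]; exists f1, f2, f3; split_symb; auto.
- now apply derives_ext with f.
- intros t Ht; rewrite <- E by exact Ht; now apply B0.
Qed.

Lemma Rpower_pos t p : 0 < Rpower t p.
Proof. apply exp_pos. Qed.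

Lemma Rpower_antitone t p q : 0 < t < 1 -> q <= p -> Rpower t p <= Rpower t q.
Proof.
intros Ht H; unfold Rpower.
assert (ln t < 0) by (rewrite <- ln_1; apply ln_increasing; lra).
destruct (Req_dec p q) as [->|]; [lra|].
left; apply exp_increasing; nra.
Qed.

Lemma near_zero_bound_le M N p q f : 0 <= M -> M <= N -> q <= p ->
  near_zero_bound M p f -> near_zero_bound N q f.
Proof.
intros HM HN Hq H t Ht.
apply Rle_trans with (1 := H t Ht).
generalize (Rpower_antitone t p q Ht Hq) (Rpower_pos t p); intros; nra.
Qed.

Lemma symb_le j k M N p q f : (j <= k)%nat -> M <= N -> q <= p ->
  symb j M p f -> symb k N q f.
Proof.
intros Hj HN Hq (HM & f1 & f2 & f3 & D & B0 & B1 & B2 & B3).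
split; [lra|]; exists f1, f2, f3; destruct D as (D1 & D2 & D3); split_symb; auto.
- apply near_zero_bound_le with M p; auto; apply B0; lia.
- apply near_zero_bound_le with M (p - 1); auto; [lra|]; apply B1; lia.
- apply near_zero_bound_le with M (p - 2); auto; [lra|]; apply B2; lia.
- apply near_zero_bound_le with M (p - 3); auto; lra.
Qed.

Lemma near_zero_bound_plus M N p f g : near_zero_bound M p f -> near_zero_bound N p g ->
  near_zero_bound (M + N) p (fun t => f t + g t).
Proof.
intros Hf Hg t Ht.
generalize (Hf t Ht) (Hg t Ht) (Rabs_triang (f t) (g t)); lra.
Qed.

Lemma derives_plus f g f' g' : derives f f' -> derives g g' ->
  derives (fun t => f t + g t) (fun t => f' t + g' t).
Proof.
intros Hf Hg t Ht; apply (is_derive_plus f g t); auto.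
Qed.

Lemma symb_plus j M N p f g : symb j M p f -> symb j N p g ->
  symb j (M + N) p (fun t => f t + g t).
Proof.
intros (HM & f1 & f2 & f3 & (D1 & D2 & D3) & B0 & B1 & B2 & B3)
       (HN & g1 & g2 & g3 & (E1 & E2 & E3) & C0 & C1 & C2 & C3).
split; [lra|].
exists (fun t => f1 t + g1 t), (fun t => f2 t + g2 t), (fun t => f3 t + g3 t).
split_symb; try apply derives_plus; try apply near_zero_bound_plus; auto.
Qed.

Lemma near_zero_bound_mult M N p q f g : 0 <= M ->
  near_zero_bound M p f -> near_zero_bound N q g ->
  near_zero_bound (M * N) (p + q) (fun t => f t * g t).
Proof.
intros HM Hf Hg t Ht.
rewrite Rabs_mult, Rpower_plus.
generalize (Hf t Ht) (Hg t Ht) (Rabs_pos (f t)) (Rabs_pos (g t)) (Rpower_pos t p); intros.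
apply Rle_trans with ((M * Rpower t p) * (N * Rpower t q)); [|right; ring].
apply Rmult_le_compat; lra.
Qed.

Lemma near_zero_bound_ext_exp M p q f : p = q -> near_zero_bound M p f -> near_zero_bound M q f.
Proof. now intros ->. Qed.

Lemma derives_mult f g f' g' : derives f f' -> derives g g' ->
  derives (fun t => f t * g t) (fun t => f' t * g t + f t * g' t).
Proof.
intros Hf Hg t Ht; apply is_derive_prod; auto.
Qed.

(** The Leibniz rule mixes all lower orders of both factors, so both need bounds from order 0 on.
    The 8 counts the terms of the third derivative of a product before equal ones are merged. *)
Lemma symb_mult M N p q f g : symb 0 M p f -> symb 0 N q g ->
  symb 0 (8 * (M * N)) (p + q) (fun t => f t * g t).
Proof.
intros (HM & f1 & f2 & f3 & (D1 & D2 & D3) & B0 & B1 & B2 & B3)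
       (HN & g1 & g2 & g3 & (E1 & E2 & E3) & C0 & C1 & C2 & C3).
specialize (B0 (le_n _)); specialize (C0 (le_n _)).
specialize (B1 ltac:(lia)); specialize (C1 ltac:(lia)).
specialize (B2 ltac:(lia)); specialize (C2 ltac:(lia)).
assert (0 <= M * N) by now apply Rmult_le_pos.
split; [lra|].
(* Equal terms stay unmerged so that [derives_plus] and [derives_mult] match syntactically. *)
exists (fun t => f1 t * g t + f t * g1 t),
  (fun t => (f2 t * g t + f1 t * g1 t) + (f1 t * g1 t + f t * g2 t)),
  (fun t => ((f3 t * g t + f2 t * g1 t) + (f2 t * g1 t + f1 t * g2 t)) +
            ((f2 t * g1 t + f1 t * g2 t) + (f1 t * g2 t + f t * g3 t))).
split_symb.
1-3: repeat first [eassumption | simple apply derives_plus | simple apply derives_mult].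
- apply near_zero_bound_le with (M * N) (p + q); try lra.
  now apply near_zero_bound_mult.
- apply near_zero_bound_le with (M * N + M * N) (p + q - 1); try lra.
  apply near_zero_bound_plus.
  + apply near_zero_bound_ext_exp with (p - 1 + q); [ring|]; now apply near_zero_bound_mult.
  + apply near_zero_bound_ext_exp with (p + (q - 1)); [ring|]; now apply near_zero_bound_mult.
- apply near_zero_bound_le with ((M * N + M * N) + (M * N + M * N)) (p + q - 2); try lra.
  repeat apply near_zero_bound_plus.
  + apply near_zero_bound_ext_exp with (p - 2 + q); [ring|]; now apply near_zero_bound_mult.
  + apply near_zero_bound_ext_exp with (p - 1 + (q - 1)); [ring|]; now apply near_zero_bound_mult.
  + apply near_zero_bound_ext_exp with (p - 1 + (q - 1)); [ring|]; now apply near_zero_bound_mult.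
  + apply near_zero_bound_ext_exp with (p + (q - 2)); [ring|]; now apply near_zero_bound_mult.
- apply near_zero_bound_le with
    (((M * N + M * N) + (M * N + M * N)) + ((M * N + M * N) + (M * N + M * N)))
    (p + q - 3); try lra.
  assert (H21 : near_zero_bound (M * N) (p + q - 3) (fun t => f2 t * g1 t)).
  { apply near_zero_bound_ext_exp with (p - 2 + (q - 1)); [ring|]; now apply near_zero_bound_mult. }
  assert (H12 : near_zero_bound (M * N) (p + q - 3) (fun t => f1 t * g2 t)).
  { apply near_zero_bound_ext_exp with (p - 1 + (q - 2)); [ring|]; now apply near_zero_bound_mult. }
  repeat apply near_zero_bound_plus; trivial.
  + apply near_zero_bound_ext_exp with (p - 3 + q); [ring|]; now apply near_zero_bound_mult.
  + apply near_zero_bound_ext_exp with (p + (q - 3)); [ring|]; now apply near_zero_bound_mult.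
Qed.

Lemma symb_scal j M N p c f : Rabs c <= N -> symb j M p f ->
  symb j (N * M) p (fun t => c * f t).
Proof.
intros Hc (HM & f1 & f2 & f3 & (D1 & D2 & D3) & B0 & B1 & B2 & B3).
assert (HN : 0 <= N) by (generalize (Rabs_pos c); lra).
assert (K : forall q g, near_zero_bound M q g -> near_zero_bound (N * M) q (fun t => c * g t)).
{ intros q g H t Ht; rewrite Rabs_mult, Rmult_assoc.
  apply Rmult_le_compat; auto; apply Rabs_pos. }
split; [now apply Rmult_le_pos|].
exists (fun t => c * f1 t), (fun t => c * f2 t), (fun t => c * f3 t).
split_symb; auto.
all: intros t Ht; apply (is_derive_scal _ t c); auto.
Qed.

Lemma derives_const c : derives (fun _ => c) (fun _ => 0).
Proof. intros t _; apply (is_derive_const c). Qed.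

Lemma near_zero_bound_0 M p : 0 <= M -> near_zero_bound M p (fun _ => 0).
Proof.
intros HM t _; rewrite Rabs_R0; generalize (Rpower_pos t p); intros; nra.
Qed.

(** From order 1 on a constant has bound 0 at every exponent. With [symb_affine], this disposes of
    the first Taylor terms of the regular part. *)
Lemma symb_const c p : symb 1 0 p (fun _ => c).
Proof.
split; [lra|].
exists (fun _ => 0), (fun _ => 0), (fun _ => 0).
split_symb; try apply derives_const; try (apply near_zero_bound_0; lra).
lia.
Qed.

Lemma symb_affine c c' p : symb 2 0 p (fun t => c + c' * t).
Proof.
split; [lra|].
exists (fun _ => c'), (fun _ => 0), (fun _ => 0).
split_symb; try apply derives_const; try (apply near_zero_bound_0; lra); try lia.
intros t _; auto_derive; trivial; ring.
Qed.

(** The cube dominates at once the coefficients 1, p, p (p - 1) and p (p - 1) (p - 2) of the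
    successive derivatives. *)
Lemma symb_power p : symb 0 ((Rabs p + 3) ^ 3) p (fun t => Rpower t p).
Proof.
assert (D : forall c q, derives (fun t => c * Rpower t q) (fun t => (c * q) * Rpower t (q - 1))).
{ intros c q t Ht; rewrite Rmult_assoc; apply (is_derive_scal _ t c).
  apply is_derive_Reals; apply derivable_pt_lim_power; lra. }
assert (K : forall c q, Rabs c <= (Rabs p + 3) ^ 3 ->
  near_zero_bound ((Rabs p + 3) ^ 3) q (fun t => c * Rpower t q)).
{ intros c q Hc t Ht; rewrite Rabs_mult, (Rabs_pos_eq (Rpower _ _)) by (left; apply Rpower_pos).
  apply Rmult_le_compat_r; [left; apply Rpower_pos|exact Hc]. }
assert (0 <= Rabs p) by apply Rabs_pos.
assert (Rabs (p - 1) <= Rabs p + 3) by (apply Rle_trans with (1 := Rabs_triang p (-1)); rewrite (Rabs_left (-1)); lra).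
assert (Rabs (p - 1 - 1) <= Rabs p + 3).
{ replace (p - 1 - 1) with (p + -2) by ring.
  apply Rle_trans with (1 := Rabs_triang p (-2)); rewrite (Rabs_left (-2)); lra. }
assert (Rabs (p * (p - 1)) <= (Rabs p + 3) ^ 2).
{ rewrite Rabs_mult; simpl; rewrite Rmult_1_r; apply Rmult_le_compat; try apply Rabs_pos; lra. }
split; [apply pow_le; lra|].
exists (fun t => p * Rpower t (p - 1)), (fun t => (p * (p - 1)) * Rpower t (p - 1 - 1)),
  (fun t => (p * (p - 1) * (p - 1 - 1)) * Rpower t (p - 1 - 1 - 1)).
split_symb; trivial.
- apply derives_ext with (fun t => 1 * Rpower t p); [intros; ring|].
  generalize (D 1 p); now rewrite Rmult_1_l.
- intros t Ht; generalize (K 1 p); rewrite Rabs_R1; intros K'.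
  generalize (K' ltac:(simpl; nra) t Ht); now rewrite Rmult_1_l.
- apply K; simpl; nra.
- replace (p - 2) with (p - 1 - 1) by ring; apply K; simpl in *; nra.
- replace (p - 3) with (p - 1 - 1 - 1) by ring; apply K.
  rewrite Rabs_mult; replace ((Rabs p + 3) ^ 3) with ((Rabs p + 3) ^ 2 * (Rabs p + 3)) by ring.
  apply Rmult_le_compat; try apply Rabs_pos; lra.
Qed.

Lemma symb_PSeries M a : exp_bounded M a -> symb 0 (3 * M) 0 (PSeries a).
Proof.
intros H.
assert (HM := exp_bounded_nonneg _ _ H).
assert (H1 := exp_bounded_derive _ _ H).
assert (H2 := exp_bounded_derive _ _ H1).
assert (H3 := exp_bounded_derive _ _ H2).
assert (D : forall b, exp_bounded M b -> derives (PSeries b) (PSeries (PS_derive b))).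
{ intros b Hb t Ht; apply is_derive_PSeries; now apply exp_bounded_radius with M. }
assert (K : forall b q, exp_bounded M b -> q <= 0 -> near_zero_bound (3 * M) q (PSeries b)).
{ intros b q Hb Hq; apply near_zero_bound_le with (3 * M) 0; try lra.
  intros t Ht; rewrite Rpower_O by lra; rewrite Rmult_1_r; now apply exp_bounded_PSeries. }
split; [lra|].
exists (PSeries (PS_derive a)), (PSeries (PS_derive (PS_derive a))),
  (PSeries (PS_derive (PS_derive (PS_derive a)))).
split_symb; auto; apply K; auto; lra.
Qed.

Lemma Rabs_ln_le t : 0 < t < 1 -> Rabs (ln t) <= / t.
Proof.
intros Ht.
assert (ln t < 0) by (rewrite <- ln_1; apply ln_increasing; lra).
rewrite Rabs_left, <- ln_Rinv by lra.
assert (0 < / t) by (apply Rinv_0_lt_compat; lra).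
destruct (Rle_lt_dec (ln (/ t)) (/ t)) as [L|L]; [exact L|exfalso].
apply exp_increasing in L; rewrite exp_ln in L by lra.
generalize (exp_ineq1 (/ t) ltac:(lra)); lra.
Qed.

Lemma is_derive_ln_pos t : 0 < t -> is_derive ln t (/ t).
Proof. intros Ht; apply is_derive_Reals; now apply derivable_pt_lim_ln. Qed.

Lemma Rpower_opp_nat t n : 0 < t -> Rpower t (- INR n) = / t ^ n.
Proof. intros Ht; rewrite Rpower_Ropp, Rpower_pow; trivial. Qed.

(** The logarithm itself is unbounded, but its derivatives are pure powers of the right size for
    exponent 0. *)
Lemma symb_ln : symb 1 2 0 ln.
Proof.
split; [lra|].
exists (fun t => / t), (fun t => - / t ^ 2), (fun t => 2 * / t ^ 3).
split_symb; try lia.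
- intros t Ht; apply is_derive_ln_pos; lra.
- intros t Ht; auto_derive; [lra|field; lra].
- intros t Ht; auto_derive; [simpl; nra|field; lra].
- intros t Ht; replace (0 - 1) with (- INR 1) by (simpl; ring); rewrite Rpower_opp_nat by lra.
  assert (0 < / t ^ 1) by (apply Rinv_0_lt_compat, pow_lt; lra).
  rewrite Rabs_pos_eq; rewrite pow_1 in *; lra.
- intros t Ht; replace (0 - 2) with (- INR 2) by (simpl; ring); rewrite Rpower_opp_nat by lra.
  assert (0 < / t ^ 2) by (apply Rinv_0_lt_compat, pow_lt; lra).
  rewrite Rabs_Ropp, Rabs_pos_eq; lra.
- intros t Ht; replace (0 - 3) with (- INR 3) by (simpl; ring); rewrite Rpower_opp_nat by lra.
  assert (0 < / t ^ 3) by (apply Rinv_0_lt_compat, pow_lt; lra).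
  rewrite Rabs_pos_eq; lra.
Qed.

Lemma Rinv_pow_ge t m n : 0 < t < 1 -> (m <= n)%nat -> / t ^ m <= / t ^ n.
Proof.
intros Ht H; apply Rinv_le_contravar; [apply pow_lt; lra|].
replace n with (m + (n - m))%nat by lia; rewrite pow_add.
assert (t ^ (n - m) <= 1) by (rewrite <- (pow1 (n - m)); apply pow_incr; lra).
generalize (pow_lt t m ltac:(lra)); intros; nra.
Qed.

Lemma derives_mul_ln : derives (fun t => t * ln t) (fun t => ln t + 1).
Proof. intros t Ht; auto_derive; [lra|field; lra]. Qed.

(** The full exponent 1 is reached only from order 2 on, once the logarithm has been differentiated
    away. It is needed when [nu = 1]. *)
Lemma symb_mul_ln : symb 2 1 1 (fun t => t * ln t).
Proof.
split; [lra|].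
exists (fun t => ln t + 1), (fun t => / t), (fun t => - / t ^ 2).
split_symb; try lia.
- exact derives_mul_ln.
- intros t Ht; auto_derive; [lra|field; lra].
- intros t Ht; auto_derive; [lra|field; lra].
- intros t Ht; replace (1 - 2) with (- INR 1) by (simpl; ring); rewrite Rpower_opp_nat by lra.
  assert (0 < / t ^ 1) by (apply Rinv_0_lt_compat, pow_lt; lra).
  rewrite Rabs_pos_eq; rewrite pow_1 in *; lra.
- intros t Ht; replace (1 - 3) with (- INR 2) by (simpl; ring); rewrite Rpower_opp_nat by lra.
  assert (0 < / t ^ 2) by (apply Rinv_0_lt_compat, pow_lt; lra).
  rewrite Rabs_Ropp, Rabs_pos_eq; lra.
Qed.

(** One power is given up, and |ln t| <= 1/t then controls order 1 as well. *)
Lemma symb_mul_ln_0 : symb 1 2 0 (fun t => t * ln t).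
Proof.
split; [lra|].
exists (fun t => ln t + 1), (fun t => / t), (fun t => - / t ^ 2).
split_symb; try lia.
- exact derives_mul_ln.
- intros t Ht; auto_derive; [lra|field; lra].
- intros t Ht; auto_derive; [lra|field; lra].
- intros t Ht; replace (0 - 1) with (- INR 1) by (simpl; ring); rewrite Rpower_opp_nat by lra.
  apply Rle_trans with (1 := Rabs_triang _ _); rewrite Rabs_R1.
  generalize (Rabs_ln_le t Ht) (Rinv_pow_ge t 0 1 Ht ltac:(lia)); simpl.
  rewrite Rmult_1_r, Rinv_1; lra.
- intros t Ht; replace (0 - 2) with (- INR 2) by (simpl; ring); rewrite Rpower_opp_nat by lra.
  assert (0 < / t ^ 1) by (apply Rinv_0_lt_compat, pow_lt; lra).
  generalize (Rinv_pow_ge t 1 2 Ht ltac:(lia)).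
  rewrite Rabs_pos_eq; rewrite pow_1 in *; lra.
- intros t Ht; replace (0 - 3) with (- INR 3) by (simpl; ring); rewrite Rpower_opp_nat by lra.
  assert (0 < / t ^ 2) by (apply Rinv_0_lt_compat, pow_lt; lra).
  generalize (Rinv_pow_ge t 2 3 Ht ltac:(lia)).
  rewrite Rabs_Ropp, Rabs_pos_eq; lra.
Qed.

(** Giving up one power yields bounds from order 0 on, which a factor in [symb_mult] must have. *)
Lemma symb_sq_ln : symb 0 5 1 (fun t => t ^ 2 * ln t).
Proof.
split; [lra|].
exists (fun t => 2 * (t * ln t) + t), (fun t => 2 * ln t + 3), (fun t => 2 * / t).
assert (L : forall t, 0 < t < 1 -> Rabs (t * ln t) <= 1).
{ intros t Ht; rewrite Rabs_mult, Rabs_pos_eq by lra.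
  apply Rle_trans with (t * / t); [|right; field; lra].
  apply Rmult_le_compat_l; [lra|now apply Rabs_ln_le]. }
split_symb; try lia.
- intros t Ht; auto_derive; [lra|field; lra].
- intros t Ht; auto_derive; [lra|field; lra].
- intros t Ht; auto_derive; [lra|field; lra].
- intros t Ht; rewrite Rpower_1 by lra.
  replace (t ^ 2 * ln t) with (t * (t * ln t)) by ring.
  rewrite Rabs_mult, Rabs_pos_eq by lra; generalize (L t Ht); nra.
- intros t Ht; replace (1 - 1) with 0 by ring; rewrite Rpower_O by lra.
  apply Rle_trans with (1 := Rabs_triang _ _); rewrite Rabs_mult, (Rabs_pos_eq 2), (Rabs_pos_eq t) by lra.
  generalize (L t Ht); lra.
- intros t Ht; replace (1 - 2) with (- INR 1) by (simpl; ring); rewrite Rpower_opp_nat by lra.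
  apply Rle_trans with (1 := Rabs_triang _ _); rewrite Rabs_mult, (Rabs_pos_eq 2), (Rabs_pos_eq 3) by lra.
  generalize (Rabs_ln_le t Ht) (Rinv_pow_ge t 0 1 Ht ltac:(lia)); simpl.
  rewrite Rmult_1_r, Rinv_1; lra.
- intros t Ht; replace (1 - 3) with (- INR 2) by (simpl; ring); rewrite Rpower_opp_nat by lra.
  assert (0 < / t ^ 1) by (apply Rinv_0_lt_compat, pow_lt; lra).
  generalize (Rinv_pow_ge t 1 2 Ht ltac:(lia)).
  rewrite Rabs_pos_eq; rewrite pow_1 in *; lra.
Qed.

(** * Taylor remainders of series, with and without a logarithm *)

Lemma PSeries_peel M a t : exp_bounded M a -> 0 < t < 1 ->
  PSeries a t = a 0%nat + t * PSeries (PS_decr_1 a) t.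
Proof. intros H Ht; apply PSeries_decr_1; now apply ex_exp_bounded with M. Qed.

Lemma PSeries_peel2 M a t : exp_bounded M a -> 0 < t < 1 ->
  PSeries a t = a 0%nat + a 1%nat * t + t ^ 2 * PSeries (PS_decr_1 (PS_decr_1 a)) t.
Proof.
intros H Ht.
rewrite (PSeries_peel M a), (PSeries_peel M (PS_decr_1 a)); trivial.
- unfold PS_decr_1; ring.
- now apply exp_bounded_decr.
Qed.

Lemma PSeries_zero a t : (forall m, a m = 0) -> PSeries a t = 0.
Proof. intros H; rewrite (PSeries_ext a (fun _ => 0)); trivial; apply PSeries_const_0. Qed.

Lemma symb_pow_PSeries M a n q : exp_bounded M a -> q <= INR n ->
  symb 0 (8 * ((Rabs (INR n) + 3) ^ 3 * (3 * M))) q (fun t => t ^ n * PSeries a t).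
Proof.
intros H Hq.
apply symb_ext with (fun t => Rpower t (INR n) * PSeries a t).
{ intros t Ht; now rewrite Rpower_pow by lra. }
eapply symb_le with (p := INR n + 0); [apply le_n|apply Rle_refl|lra|].
apply symb_mult; [apply symb_power|now apply symb_PSeries].
Qed.

Lemma Rpower_succ t p : 0 < t -> Rpower t (p + 1) = Rpower t p * t.
Proof. intros Ht; now rewrite Rpower_plus, Rpower_1. Qed.

Section Logarithm.
Variables (M : R) (v : nat -> R).
Hypothesis Hv : exp_bounded M v.

Let tail := PSeries (PS_decr_1 (PS_decr_1 v)).

(** [symb_mult] cannot treat the product, since ln t has no bound at order 0. The terms of degree 0
    and 1 are split off and treated by hand; the factor t^2 tames the logarithm in the rest. *)
Lemma log_split t : 0 < t < 1 -> PSeries v t * ln t =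
  v 0%nat * ln t + (v 1%nat * (t * ln t) + (t ^ 2 * ln t) * tail t).
Proof. intros Ht; rewrite (PSeries_peel2 M v t Hv Ht); unfold tail; ring. Qed.

Lemma symb_log_tail : symb 0 (8 * (5 * (3 * M))) 1 (fun t => (t ^ 2 * ln t) * tail t).
Proof.
eapply symb_le with (p := 1 + 0); [apply le_n|apply Rle_refl|lra|].
apply symb_mult; [apply symb_sq_ln|].
now apply symb_PSeries, exp_bounded_decr, exp_bounded_decr.
Qed.

Lemma symb_log_0 : symb 1 (M * 2 + (M * 2 + 8 * (5 * (3 * M)))) 0 (fun t => PSeries v t * ln t).
Proof.
eapply symb_ext; [intros t Ht; symmetry; exact (log_split t Ht)|].
apply symb_plus; [|apply symb_plus].
- apply symb_scal; [now apply exp_bounded_const|apply symb_ln].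
- apply symb_scal; [now apply exp_bounded_const|apply symb_mul_ln_0].
- eapply symb_le with (p := 1); [| | |apply symb_log_tail]; [lia|lra|lra].
Qed.

(** For [nu = 1] the exponent aimed at is 2 - nu = 1, which [v 0 * ln t] misses; that term is the
    one to be matched with the Stokes kernel. *)
Lemma symb_log_1 : symb 2 (M * 1 + 8 * (5 * (3 * M))) 1 (fun t => PSeries v t * ln t - v 0%nat * ln t).
Proof.
eapply symb_ext with (f := fun t => v 1%nat * (t * ln t) + (t ^ 2 * ln t) * tail t).
{ intros t Ht; rewrite (log_split t Ht); ring. }
apply symb_plus.
- apply symb_scal; [now apply exp_bounded_const|apply symb_mul_ln].
- eapply symb_le with (p := 1); [| | |apply symb_log_tail]; [lia|lra|lra].
Qed.
End Logarithm.

(** * The radial profile of the kernel and its remainders *)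

Definition profile (nu : R) (u v w : nat -> R) (t : R) : R :=
  PSeries u t + PSeries v t * ln t + Rpower t (- nu) * PSeries w t.

Lemma profile_symb_1 M nu : 0 <= M -> 0 < nu -> exists K, forall u v w,
  exp_bounded M u -> exp_bounded M v -> exp_bounded M w ->
  1 <= nu \/ (forall m, v m = 0) ->
  symb 1 K (1 - nu) (fun t => profile nu u v w t - w 0%nat * Rpower t (- nu)).
Proof.
intros HM Hnu; eexists; intros u v w Hu Hv Hw Hc.
apply symb_ext with (fun t => (u 0%nat + t ^ 1 * PSeries (PS_decr_1 u) t) +
  (PSeries v t * ln t + Rpower t (1 - nu) * PSeries (PS_decr_1 w) t)).
{ intros t Ht; unfold profile.
  rewrite (PSeries_peel M u), (PSeries_peel M w) by trivial.
  replace (1 - nu) with (- nu + 1) by ring; rewrite Rpower_succ by lra; ring. }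
apply symb_plus; [apply symb_plus|apply symb_plus].
- apply symb_const.
- eapply symb_le; [| | |apply symb_pow_PSeries with (q := 1 - nu)].
  + lia.
  + apply Rle_refl.
  + apply Rle_refl.
  + apply exp_bounded_decr, Hu.
  + simpl; lra.
(* The bound of [symb_log_0] is fixed before the case split, so that [K] is the same in both
   cases. *)
- instantiate (1 := (M * 2 + (M * 2 + 8 * (5 * (3 * M))))).
  destruct Hc as [Hc|Hc].
  + eapply symb_le; [| | |now apply symb_log_0]; [lia|lra|lra].
  + apply symb_ext with (fun _ => 0).
    { intros t Ht; rewrite PSeries_zero; trivial; ring. }
    eapply symb_le; [| | |apply (symb_const 0 (1 - nu))]; [lia|lra|lra].
- apply symb_le with 0%nat (8 * ((Rabs (1 - nu) + 3) ^ 3 * (3 * M))) (1 - nu + 0); [lia|apply Rle_refl|lra|].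
  apply symb_mult; [apply symb_power|now apply symb_PSeries, exp_bounded_decr].
Qed.

(** At t = r |y|^2 this is, up to factors and additive constants, the fundamental solution of the
    biharmonic operator: |y|^(4 - d), or log |y| when d = 4. *)
Definition power_primitive (nu kappa t : R) : R :=
  if Req_EM_T nu 1 then kappa * ln t else kappa / (1 - nu) * Rpower t (1 - nu).

Lemma derives_power_primitive nu kappa :
  derives (power_primitive nu kappa) (fun t => kappa * Rpower t (- nu)).
Proof.
intros t Ht; unfold power_primitive; destruct (Req_EM_T nu 1) as [->|E].
- apply (is_derive_scal ln t kappa).
  rewrite Rpower_Ropp, Rpower_1 by lra; apply is_derive_ln_pos; lra.
- replace (kappa * Rpower t (- nu)) with
    (kappa / (1 - nu) * ((1 - nu) * Rpower t (1 - nu - 1))).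
  + apply (is_derive_scal (fun t => Rpower t (1 - nu)) t).
    apply is_derive_Reals, derivable_pt_lim_power; lra.
  + replace (1 - nu - 1) with (- nu) by ring; field; lra.
Qed.

(** The conditions on [kappa] identify the term to subtract: w 1 * t^(1 - nu) if nu differs from 1,
    and [v 0 * ln t] if [nu = 1], where that power degenerates to a constant. For nu >= 2 the
    exponent 2 - nu is at most 0, so that [symb_log_0] suffices for the logarithms. *)
Lemma profile_symb_2 M nu : 0 <= M -> 0 < nu -> exists K, forall u v w kappa,
  exp_bounded M u -> exp_bounded M v -> exp_bounded M w ->
  nu = 1 \/ 2 <= nu \/ (forall m, v m = 0) ->
  (nu = 1 -> w 1%nat = 0 /\ v 0%nat = kappa) ->
  (nu <> 1 -> w 1%nat * (1 - nu) = kappa) ->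
  symb 2 K (2 - nu) (fun t =>
    profile nu u v w t - w 0%nat * Rpower t (- nu) - power_primitive nu kappa t).
Proof.
intros HM Hnu; eexists; intros u v w kappa Hu Hv Hw Hc H1 H2.
apply symb_ext with (fun t =>
  ((u 0%nat + u 1%nat * t) + t ^ 2 * PSeries (PS_decr_1 (PS_decr_1 u)) t) +
  ((PSeries v t * ln t - (if Req_EM_T nu 1 then v 0%nat * ln t else 0)) +
   Rpower t (2 - nu) * PSeries (PS_decr_1 (PS_decr_1 w)) t)).
{ intros t Ht; unfold profile, power_primitive.
  rewrite (PSeries_peel2 M u), (PSeries_peel2 M w) by trivial.
  replace (2 - nu) with (- nu + 1 + 1) by ring; rewrite !Rpower_succ by lra.
  destruct (Req_EM_T nu 1) as [E|E].
  - destruct (H1 E) as [-> ->]; ring.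
  - replace (1 - nu) with (- nu + 1) at 2 by ring; rewrite Rpower_succ by lra.
    rewrite <- H2 by exact E; field; lra. }
apply symb_plus; [apply symb_plus|apply symb_plus].
- apply symb_affine.
- eapply symb_le; [| | |apply symb_pow_PSeries with (q := 2 - nu)].
  + lia.
  + apply Rle_refl.
  + apply Rle_refl.
  + apply exp_bounded_decr, exp_bounded_decr, Hu.
  + simpl; lra.
- instantiate (1 := (M * 2 + (M * 2 + 8 * (5 * (3 * M))))).
  destruct (Req_EM_T nu 1) as [E|E]; [|destruct Hc as [Hc|[Hc|Hc]]; [easy| |]].
  + eapply symb_le; [| | |now apply symb_log_1]; [lia|lra|lra].
  + apply symb_ext with (fun t => PSeries v t * ln t); [intros; ring|].
    eapply symb_le; [| | |now apply symb_log_0]; [lia|lra|lra].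
  + apply symb_ext with (fun _ => 0).
    { intros t Ht; rewrite PSeries_zero; trivial; ring. }
    eapply symb_le; [| | |apply (symb_const 0 (2 - nu))]; [lia|lra|lra].
- apply symb_le with 0%nat (8 * ((Rabs (2 - nu) + 3) ^ 3 * (3 * M))) (2 - nu + 0); [lia|apply Rle_refl|lra|].
  apply symb_mult; [apply symb_power|now apply symb_PSeries, exp_bounded_decr, exp_bounded_decr].
Qed.

(** * Partial derivatives of radial functions *)

Lemma Rsum_S d f : Rsum (S d) f = Rsum d f + f d.
Proof.
unfold Rsum; rewrite seq_S, map_app, fold_right_app; simpl.
generalize (f d); intros c.
induction (map f (seq 0 d)) as [|x l IH]; simpl; [ring|rewrite IH; ring].
Qed.

Lemma Rsum_ext d f g : (forall i, (i < d)%nat -> f i = g i) -> Rsum d f = Rsum d g.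
Proof.
induction d as [|d IH]; intros H; [reflexivity|].
rewrite !Rsum_S, IH, H; auto.
Qed.

Lemma Rsum_le_const d f K : (forall i, (i < d)%nat -> f i <= K) -> Rsum d f <= INR d * K.
Proof.
induction d as [|d IH]; intros H; [unfold Rsum; simpl; lra|].
rewrite Rsum_S, S_INR; generalize (H d ltac:(lia)) (IH ltac:(auto)); lra.
Qed.

Lemma Rsum_nonneg d f : (forall i, (i < d)%nat -> 0 <= f i) -> 0 <= Rsum d f.
Proof.
induction d as [|d IH]; intros H; [unfold Rsum; simpl; lra|].
rewrite Rsum_S; generalize (H d ltac:(lia)) (IH ltac:(auto)); lra.
Qed.

Definition sqnorm (d : nat) (y : nat -> R) : R := Rsum d (fun i => y i ^ 2).

Lemma sqnorm_nonneg d y : 0 <= sqnorm d y.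
Proof. apply Rsum_nonneg; intros; apply pow2_ge_0. Qed.

Lemma coord_le_sqnorm d y a : (a < d)%nat -> y a ^ 2 <= sqnorm d y.
Proof.
unfold sqnorm; induction d as [|d IH]; intros H; [lia|].
rewrite Rsum_S; destruct (Nat.eq_dec a d) as [->|E].
- generalize (sqnorm_nonneg d y); unfold sqnorm; lra.
- generalize (IH ltac:(lia)) (pow2_ge_0 (y d)); lra.
Qed.

Lemma upd_eq x a t : upd x a t a = t.
Proof. unfold upd; now rewrite Nat.eqb_refl. Qed.

Lemma upd_neq x a t j : j <> a -> upd x a t j = x j.
Proof. intros H; unfold upd; now apply Nat.eqb_neq in H as ->. Qed.

Lemma upd_id x a : upd x a (x a) = x.
Proof.
apply functional_extensionality; intros j; unfold upd.
destruct (Nat.eqb_spec j a); congruence.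
Qed.

Lemma sqnorm_upd d x a t : (a < d)%nat ->
  sqnorm d (upd x a t) = sqnorm d x - x a ^ 2 + t ^ 2.
Proof.
unfold sqnorm; induction d as [|d IH]; intros H; [lia|].
rewrite !Rsum_S; destruct (Nat.eq_dec a d) as [->|E].
- rewrite upd_eq, (Rsum_ext d _ (fun i => x i ^ 2)); [ring|].
  intros i Hi; rewrite upd_neq; [reflexivity|lia].
- rewrite IH, upd_neq by lia; ring.
Qed.

Definition partial (f : (nat -> R) -> R) (a : nat) (x : nat -> R) (l : R) : Prop :=
  is_derive (fun t => f (upd x a t)) (x a) l.

Lemma pdR_partial f a x l : partial f a x l -> pdR f a x = l.
Proof.
intros H; apply is_derive_Reals in H; unfold pdR.
apply (uniqueness_limite (fun t => f (upd x a t)) (x a)); [|exact H].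
apply (epsilon_spec (inhabits 0)
  (fun l => derivable_pt_lim (fun t => f (upd x a t)) (x a) l)); now exists l.
Qed.

Lemma partial_sqnorm d a x : (a < d)%nat -> partial (sqnorm d) a x (2 * x a).
Proof.
intros H; unfold partial.
apply is_derive_ext with (fun t => sqnorm d x - x a ^ 2 + t ^ 2).
- intros t; symmetry; now apply sqnorm_upd.
- auto_derive; trivial; ring.
Qed.

Lemma partial_coord b a x : partial (fun y => y b) a x (kron a b).
Proof.
unfold partial, kron; destruct (Nat.eqb_spec a b) as [->|E].
- apply is_derive_ext with (fun t => t); [intros; now rewrite upd_eq|].
  apply (is_derive_id (x b)).
- apply is_derive_ext with (fun t => x b); [intros; now rewrite upd_neq by auto|].
  apply (is_derive_const (x b)).
Qed.

Lemma partial_plus f g a x l m : partial f a x l -> partial g a x m ->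
  partial (fun y => f y + g y) a x (l + m).
Proof. intros Hf Hg; exact (is_derive_plus _ _ _ _ _ Hf Hg). Qed.

Lemma partial_mult f g a x l m : partial f a x l -> partial g a x m ->
  partial (fun y => f y * g y) a x (l * g x + f x * m).
Proof.
intros Hf Hg; generalize (is_derive_prod _ _ _ _ _ Hf Hg); now rewrite upd_id.
Qed.

Lemma partial_scal c f a x l : partial f a x l -> partial (fun y => c * f y) a x (c * l).
Proof. intros Hf; exact (is_derive_scal _ _ c _ Hf). Qed.

(** The kernel identities hold for 0 < r |y|^2 < 1 only; by continuity this condition persists near
    the point along a coordinate line. *)
Lemma partial_ext_loc d r f g a x l : (a < d)%nat ->
  (forall y, 0 < r * sqnorm d y < 1 -> f y = g y) ->
  0 < r * sqnorm d x < 1 -> partial f a x l -> partial g a x l.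
Proof.
intros Ha E Hx; apply is_derive_ext_loc.
assert (C : continuous (fun t => r * (sqnorm d x - x a ^ 2 + t ^ 2)) (x a)).
{ apply (ex_derive_continuous (V := R_NormedModule)); auto_derive; trivial. }
assert (L : locally (r * (sqnorm d x - x a ^ 2 + x a ^ 2)) (fun s => 0 < s < 1)).
{ apply locally_unit; [auto|].
  replace (sqnorm d x - x a ^ 2 + x a ^ 2) with (sqnorm d x) by ring; exact Hx. }
generalize (C _ L); unfold filtermap; apply filter_imp.
intros t Ht; apply E; now rewrite sqnorm_upd.
Qed.

Lemma partial_radial d r e e1 a x : (a < d)%nat -> derives e e1 ->
  0 < r * sqnorm d x < 1 ->
  partial (fun y => e (r * sqnorm d y)) a x (2 * r * x a * e1 (r * sqnorm d x)).
Proof.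
intros Ha He Hx.
assert (H := partial_scal r _ _ _ _ (partial_sqnorm d a x Ha)).
assert (He' := He _ Hx); rewrite <- (upd_id x a) in He' at 1.
generalize (is_derive_comp e (fun t => r * sqnorm d (upd x a t)) (x a) _ _ He' H).
unfold partial.
replace (2 * r * x a * e1 (r * sqnorm d x)) with
  (scal (r * (2 * x a)) (e1 (r * sqnorm d x))); [easy|].
unfold scal; simpl; unfold mult; simpl; ring.
Qed.

Lemma pdR_radial d r R0 e e1 (F : (nat -> R) -> R) b y : (b < d)%nat -> derives e e1 ->
  (forall y, 0 < r * sqnorm d y < 1 -> F y = R0 * e (r * sqnorm d y)) ->
  0 < r * sqnorm d y < 1 ->
  pdR F b y = R0 * (2 * r * y b * e1 (r * sqnorm d y)).
Proof.
intros Hb He HF Hy; apply pdR_partial.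
apply partial_ext_loc with d r (fun y => R0 * e (r * sqnorm d y)); trivial.
- intros z Hz; symmetry; now apply HF.
- apply partial_scal; now apply partial_radial.
Qed.

Lemma pdR2_radial d r R0 e e1 e2 (F : (nat -> R) -> R) a b y :
  (a < d)%nat -> (b < d)%nat -> derives e e1 -> derives e1 e2 ->
  (forall y, 0 < r * sqnorm d y < 1 -> F y = R0 * e (r * sqnorm d y)) ->
  0 < r * sqnorm d y < 1 ->
  pdR (fun y => pdR F b y) a y =
    R0 * (2 * r * kron a b * e1 (r * sqnorm d y) + 4 * r ^ 2 * y a * y b * e2 (r * sqnorm d y)).
Proof.
intros Ha Hb He He1 HF Hy; apply pdR_partial.
(* The inner derivative is known at all points of the open region, so its closed form may be
   differentiated again. *)
apply partial_ext_loc with d r (fun y => (R0 * (2 * r)) * (y b * e1 (r * sqnorm d y))); trivial.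
- intros z Hz; rewrite (pdR_radial d r R0 e e1 F b z); trivial; ring.
- replace (R0 * (2 * r * kron a b * e1 (r * sqnorm d y) + 4 * r ^ 2 * y a * y b * e2 (r * sqnorm d y)))
    with ((R0 * (2 * r)) * (kron a b * e1 (r * sqnorm d y) + y b * (2 * r * y a * e2 (r * sqnorm d y)))) by ring.
  apply partial_scal, partial_mult; [apply partial_coord|now apply partial_radial].
Qed.

(** [symb] hides the derivatives behind an existential; this identifies the ones that come from
    different symbols. *)
Lemma derives_unique f g h : derives f g -> derives f h -> forall t, 0 < t < 1 -> g t = h t.
Proof.
intros Hg Hh t Ht.
now rewrite <- (is_derive_unique _ _ _ (Hg t Ht)), <- (is_derive_unique _ _ _ (Hh t Ht)).
Qed.

Lemma derives_scal c f g : derives f g -> derives (fun t => c * f t) (fun t => c * g t).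
Proof. intros H t Ht; apply (is_derive_scal f t c), H, Ht. Qed.

Lemma derives_minus f g f' g' : derives f f' -> derives g g' ->
  derives (fun t => f t - g t) (fun t => f' t - g' t).
Proof. intros Hf Hg t Ht; apply (is_derive_minus f g t); auto. Qed.

Lemma Rpower_sqnorm d k y : 0 < sqnorm d y -> Rpower (sqnorm d y) (INR k / 2) = vnorm d y ^ k.
Proof.
intros H; unfold vnorm; fold (sqnorm d y).
rewrite <- (Rpower_pow k), <- Rpower_sqrt, Rpower_mult by (try apply sqrt_lt_R0; exact H).
f_equal; field.
Qed.

Lemma kron_bound a b : Rabs (kron a b) <= 1.
Proof.
unfold kron; destruct (Nat.eqb a b); [rewrite Rabs_R1|rewrite Rabs_R0]; lra.
Qed.

Section Entry.
Variables (d : nat) (r : R) (K nu R0 : R) (e e' q1 q2 q3 : R -> R).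
Hypotheses (Hr : 0 < r) (HK : 0 <= K) (HR : 0 <= R0).
Hypotheses (De : derives e e') (D1 : derives q1 q2) (D2 : derives q2 q3).
Hypotheses (Be : near_zero_bound K (- nu) e') (B2 : near_zero_bound K (- nu) q2)
  (B3 : near_zero_bound K (- nu - 1) q3).

(** Here [e] stems from G, and [q1], [q2], [q3] are the derivatives of the remainder of the rotated
    profile for G / lambda. Differentiation in x_c leaves five kinds of terms, each at most r |x| K
    R0 t^(-nu) up to a number. *)
Lemma entry_bound (F : (nat -> R) -> R) a b c x :
  (a < d)%nat -> (b < d)%nat -> (c < d)%nat ->
  (forall y, 0 < r * sqnorm d y < 1 -> F y =
    R0 * (kron a b * e (r * sqnorm d y) - 2 * kron a b * q1 (r * sqnorm d y)
          - 4 * r * (y a * y b) * q2 (r * sqnorm d y))) ->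
  0 < r * sqnorm d x < 1 ->
  Rabs (pdR F c x) <= 22 * K * r * vnorm d x * (R0 * Rpower (r * sqnorm d x) (- nu)).
Proof.
intros Ha Hb Hc HF Hx.
set (t := r * sqnorm d x) in *.
set (P := Rpower t (- nu)).
set (rho := vnorm d x).
assert (Hs : 0 < sqnorm d x) by (unfold t in Hx; nra).
assert (Hrho2 : rho ^ 2 = sqnorm d x).
{ unfold rho; rewrite <- Rpower_sqnorm by exact Hs; simpl.
  replace ((1 + 1) / 2) with 1 by field; now apply Rpower_1. }
assert (Hrho : 0 <= rho) by apply sqrt_pos.
assert (Hcoord : forall i, (i < d)%nat -> Rabs (x i) <= rho).
{ intros i Hi; unfold rho, vnorm; rewrite <- (sqrt_Rsqr_abs (x i)).
  apply sqrt_le_1_alt; unfold Rsqr; generalize (coord_le_sqnorm d x i Hi).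
  unfold sqnorm; simpl; lra. }
assert (HP : 0 < P) by apply Rpower_pos.
assert (Ee := Be t Hx); assert (E2 := B2 t Hx); assert (E3 := B3 t Hx); fold P in Ee, E2.
(* The third derivative is worse by one power of t, but it comes with two more coordinates and one
   more r, and r |x|^2 = t. *)
assert (E3' : t * Rabs (q3 t) <= K * P).
{ replace (K * P) with (t * (K * Rpower t (- nu - 1))).
  - apply Rmult_le_compat_l; lra.
  - unfold P; replace (- nu) with (- nu - 1 + 1) at 2 by ring.
    rewrite Rpower_succ by lra; ring. }
assert (HD : partial F c x
  (R0 * (kron a b * (2 * r * x c * e' t) + - (2 * kron a b) * (2 * r * x c * q2 t)
     + - (4 * r) * ((kron c a * x b + x a * kron c b) * q2 t
                    + (x a * x b) * (2 * r * x c * q3 t))))).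
{ apply partial_ext_loc with d r (fun y =>
    R0 * (kron a b * e (r * sqnorm d y) + - (2 * kron a b) * q1 (r * sqnorm d y)
          + - (4 * r) * ((y a * y b) * q2 (r * sqnorm d y)))); trivial.
  - intros y Hy; rewrite HF by exact Hy; ring.
  - apply partial_scal, partial_plus; [apply partial_plus|]; apply partial_scal.
    + now apply partial_radial.
    + now apply partial_radial.
    + apply (partial_mult (fun y => y a * y b) (fun y => q2 (r * sqnorm d y)));
        [|now apply partial_radial].
      apply partial_mult; apply partial_coord. }
rewrite (pdR_partial _ _ _ _ HD), Rabs_mult, (Rabs_pos_eq R0) by exact HR.
replace (22 * K * r * rho * (R0 * P)) with (R0 * (22 * K * r * rho * P)) by ring.
apply Rmult_le_compat_l; [exact HR|].
assert (KB := kron_bound).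
assert (M1 : forall u v B, 0 <= B -> Rabs u <= 1 -> Rabs v <= B -> Rabs (u * v) <= B).
{ intros u v B HB Hu Hv; rewrite Rabs_mult.
  generalize (Rabs_pos u) (Rabs_pos v); nra. }
assert (Mx : forall i g B, (i < d)%nat -> 0 <= B -> Rabs g <= B -> Rabs (x i * g) <= rho * B).
{ intros i g B Hi HB Hg; rewrite Rabs_mult; apply Rmult_le_compat; auto; apply Rabs_pos. }
assert (HKP : 0 <= K * P) by (apply Rmult_le_pos; lra).
assert (HrKP : 0 <= rho * (K * P)) by (apply Rmult_le_pos; lra).
set (T1 := kron a b * (x c * e' t)).
set (T2 := kron a b * (x c * q2 t)).
set (T3 := kron c a * (x b * q2 t)).
set (T4 := kron c b * (x a * q2 t)).
set (T5 := x a * (x b * (x c * (r * q3 t)))).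
assert (L1 : Rabs T1 <= rho * (K * P)) by (apply M1; auto).
assert (L2 : Rabs T2 <= rho * (K * P)) by (apply M1; auto).
assert (L3 : Rabs T3 <= rho * (K * P)) by (apply M1; auto).
assert (L4 : Rabs T4 <= rho * (K * P)) by (apply M1; auto).
assert (L5 : Rabs T5 <= rho * (K * P)).
{ assert (Hq : Rabs (r * q3 t) <= r * Rabs (q3 t)).
  { rewrite Rabs_mult, (Rabs_pos_eq r); lra. }
  assert (0 <= r * Rabs (q3 t)) by (apply Rmult_le_pos; [lra|apply Rabs_pos]).
  apply Rle_trans with (rho * (rho * (rho * (r * Rabs (q3 t))))).
  - unfold T5; repeat (apply Mx; trivial); repeat apply Rmult_le_pos; trivial; try lra; apply Rabs_pos.
  - replace (rho * (rho * (rho * (r * Rabs (q3 t))))) with (rho * (t * Rabs (q3 t))).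
    + now apply Rmult_le_compat_l.
    + unfold t; rewrite <- Hrho2; ring. }
replace (kron a b * (2 * r * x c * e' t) + - (2 * kron a b) * (2 * r * x c * q2 t)
     + - (4 * r) * ((kron c a * x b + x a * kron c b) * q2 t
                    + (x a * x b) * (2 * r * x c * q3 t)))
  with (r * (2 * T1 - 4 * T2 - 4 * (T3 + T4) - 8 * T5)) by (unfold T1, T2, T3, T4, T5; ring).
rewrite Rabs_mult, (Rabs_pos_eq r) by lra.
replace (22 * K * r * rho * P) with (r * (22 * (rho * (K * P)))) by ring.
apply Rmult_le_compat_l; [lra|].
(* The constant is 22 = 2 + 4 + 4 (1 + 1) + 8. *)
apply Rabs_le; apply Rabs_le_between in L1, L2, L3, L4, L5; lra.
Qed.
End Entry.

(** * The gradient of the difference of the Stokes kernels *)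

Definition order (d : nat) : R := (INR d - 2) / 2.
(** Normalised so that the Laplace kernel is 4 kappa |y|^(2 - d); the two terms of the Stokes kernel
    then have coefficients 2 kappa and 4 kappa nu. *)
Definition kappa (d : nat) : R := / (4 * (INR d - 2) * omega d).

Lemma omega_pos d : 0 < omega d.
Proof.
assert (G : forall n, 0 < gh n /\ 0 < gh (S n)).
{ induction n as [|n [IH1 IH2]]; [split; simpl; [apply sqrt_lt_R0, PI_RGT_0|lra]|].
  split; [exact IH2|]; change (gh (S (S n))) with ((INR n + 1) / 2 * gh n).
  apply Rmult_lt_0_compat; [generalize (pos_INR n); lra|exact IH1]. }
unfold omega; apply Rdiv_lt_0_compat; [|apply G].
generalize (Rpower_pos PI (INR d / 2)); lra.
Qed.

Lemma vnorm_sq d y : vnorm d y ^ 2 = sqnorm d y.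
Proof.
unfold vnorm; fold (sqnorm d y); simpl; rewrite Rmult_1_r.
apply sqrt_sqrt, sqnorm_nonneg.
Qed.

Lemma Rpower_order d y : (2 <= d)%nat -> 0 < sqnorm d y ->
  Rpower (sqnorm d y) (order d) = vnorm d y ^ (d - 2).
Proof.
intros Hd Hy; rewrite <- Rpower_sqnorm by exact Hy; f_equal.
unfold order; rewrite minus_INR by exact Hd; reflexivity.
Qed.

Lemma Rpower_scaling d r y : (2 <= d)%nat -> 0 < r -> 0 < sqnorm d y ->
  Rpower r (order d) * Rpower (r * sqnorm d y) (- order d) = / vnorm d y ^ (d - 2).
Proof.
intros Hd Hr Hy; rewrite <- Rpower_mult_distr by trivial.
rewrite <- Rmult_assoc, <- Rpower_plus, Rplus_opp_r, Rpower_O, Rmult_1_l by exact Hr.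
now rewrite Rpower_Ropp, Rpower_order.
Qed.

Lemma G0_scaling d r y : (3 <= d)%nat -> 0 < r -> 0 < sqnorm d y ->
  G0 d y = 4 * kappa d * (Rpower r (order d) * Rpower (r * sqnorm d y) (- order d)).
Proof.
intros Hd Hr Hy; rewrite Rpower_scaling by (trivial; lia); unfold G0, kappa.
assert (Hv : 0 < vnorm d y) by (apply sqrt_lt_R0; exact Hy).
generalize (le_INR 3 d Hd) (omega_pos d) (pow_lt _ (d - 2) Hv); simpl; intros.
field; lra.
Qed.

Lemma Cmod_le z B : Rabs (Cre z) <= B -> Rabs (Cim z) <= B -> Cmod z ^ 2 <= 2 * B ^ 2.
Proof.
intros H1 H2; unfold Cmod.
rewrite pow2_sqrt by (generalize (pow2_ge_0 (Cre z)) (pow2_ge_0 (Cim z)); lra).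
rewrite <- (pow2_abs (Cre z)), <- (pow2_abs (Cim z)).
generalize (pow_incr _ _ 2 (conj (Rabs_pos _) H1)) (pow_incr _ _ 2 (conj (Rabs_pos _) H2)); lra.
Qed.

Lemma gradDiffNorm_le d r tau x B : 0 <= B ->
  (forall a b c, (a < d)%nat -> (b < d)%nat -> (c < d)%nat ->
    let g := pdC (fun y => Csub (Gam d r tau a b y) (RtoC (Gam0 d a b y))) c x in
    Rabs (Cre g) <= B /\ Rabs (Cim g) <= B) ->
  gradDiffNorm d r tau x <= sqrt (2 * INR d ^ 3) * B.
Proof.
intros HB H; unfold gradDiffNorm.
assert (HD := pos_INR d).
rewrite <- (sqrt_pow2 B HB) at 1; rewrite <- sqrt_mult_alt
  by (apply Rmult_le_pos; [lra|now apply pow_le]).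
apply sqrt_le_1_alt.
replace (2 * INR d ^ 3 * B ^ 2) with (INR d * (INR d * (INR d * (2 * B ^ 2)))) by ring.
apply Rsum_le_const; intros a Ha.
apply Rsum_le_const; intros b Hb.
apply Rsum_le_const; intros c Hc.
destruct (H a b c Ha Hb Hc) as [H1 H2]; exact (Cmod_le _ _ H1 H2).
Qed.

Lemma Cinv_lam r tau : 0 < r -> Cinv (lam r tau) = (cos tau / r, - sin tau / r).
Proof.
intros Hr; unfold Cinv, lam, Cre, Cim; simpl fst; simpl snd.
assert (E : (r * cos tau) ^ 2 + (r * sin tau) ^ 2 = r ^ 2).
{ generalize (sin2_cos2 tau); unfold Rsqr; intros E.
  replace ((r * cos tau) ^ 2 + (r * sin tau) ^ 2)
    with (r ^ 2 * (sin tau * sin tau + cos tau * cos tau)) by ring.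
  rewrite E; ring. }
rewrite E; f_equal; field; lra.
Qed.

Section Gradient.
Variables (d : nat) (r tau K : R) (e f : R -> R).
Hypotheses (Hd : (3 <= d)%nat) (Hr : 0 < r).
Let nu := order d.
Let R0 := Rpower r nu.
Hypothesis HG : forall y, 0 < r * sqnorm d y < 1 ->
  Csub (Gl d r tau y) (RtoC (G0 d y)) = (R0 * e (r * sqnorm d y), R0 * f (r * sqnorm d y)).
Hypotheses (He : symb 1 K (1 - nu) e) (Hf : symb 1 K (1 - nu) f).
Hypothesis Hre : symb 2 K (2 - nu)
  (fun t => cos tau * e t + sin tau * f t - power_primitive nu (kappa d) t).
Hypothesis Him : symb 2 K (2 - nu) (fun t => cos tau * f t - sin tau * e t).

(** Multiplication by 1 / lambda turns ([e], [f]) into (cos tau e + sin tau f, cos tau f - sin tau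
    e) / r. The Stokes kernel is real, so [kappa] enters the real part only. *)
Lemma Gam_diff e1 e2 f1 f2 a b y : (a < d)%nat -> (b < d)%nat ->
  derives e e1 -> derives e1 e2 -> derives f f1 -> derives f1 f2 ->
  0 < r * sqnorm d y < 1 ->
  let t := r * sqnorm d y in
  Csub (Gam d r tau a b y) (RtoC (Gam0 d a b y)) =
  (R0 * (kron a b * e t
     - 2 * kron a b * (cos tau * e1 t + sin tau * f1 t - kappa d * Rpower t (- nu))
     - 4 * r * (y a * y b) * (cos tau * e2 t + sin tau * f2 t
                              + kappa d * nu * Rpower t (- nu - 1))),
   R0 * (kron a b * f t
     - 2 * kron a b * (cos tau * f1 t - sin tau * e1 t)
     - 4 * r * (y a * y b) * (cos tau * f2 t - sin tau * e2 t))).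
Proof.
intros Ha Hb De De1 Df Df1 Hy t.
assert (HGy := HG y Hy); fold t in HGy.
unfold Gam; rewrite (Cinv_lam r tau Hr).
change (pdC (fun y => pdC (fun u => Csub (Gl d r tau u) (RtoC (G0 d u))) b y) a y) with
  (pdR (fun y => pdR (fun u => Cre (Csub (Gl d r tau u) (RtoC (G0 d u)))) b y) a y,
   pdR (fun y => pdR (fun u => Cim (Csub (Gl d r tau u) (RtoC (G0 d u)))) b y) a y).
rewrite (pdR2_radial d r R0 e e1 e2 (fun u => Cre (Csub (Gl d r tau u) (RtoC (G0 d u)))))
  by (trivial; intros z Hz; now rewrite HG).
rewrite (pdR2_radial d r R0 f f1 f2 (fun u => Cim (Csub (Gl d r tau u) (RtoC (G0 d u)))))
  by (trivial; intros z Hz; now rewrite HG).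
fold t.
assert (Hre' : Cre (Gl d r tau y) = R0 * e t + G0 d y).
{ apply (f_equal Cre) in HGy; revert HGy.
  unfold Csub, Cadd, Copp, RtoC, Cre; simpl; lra. }
assert (Him' : Cim (Gl d r tau y) = R0 * f t).
{ apply (f_equal Cim) in HGy; revert HGy.
  unfold Csub, Cadd, Copp, RtoC, Cim; simpl; lra. }
assert (Hs : 0 < sqnorm d y) by nra.
assert (Hd2 : 0 < INR d - 2) by (generalize (le_INR 3 d Hd); simpl; lra).
assert (Hv : 0 < vnorm d y) by (apply sqrt_lt_R0; exact Hs).
assert (EP : R0 * Rpower t (- nu) = / vnorm d y ^ (d - 2)).
{ apply Rpower_scaling; trivial; lia. }
assert (EP1 : R0 * r * Rpower t (- nu - 1) = / vnorm d y ^ d).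
{ replace d with (d - 2 + 2)%nat at 2 by lia.
  rewrite pow_add, vnorm_sq, Rinv_mult, <- EP.
  replace (- nu) with (- nu - 1 + 1) at 2 by ring.
  rewrite Rpower_succ by apply Hy; unfold t; field; lra. }
assert (EG0 : G0 d y = 4 * kappa d * (R0 * Rpower t (- nu))).
{ now apply G0_scaling. }
(* Of the 4 kappa in delta_ab G0, the Hessian of the primitive takes away 2 kappa; its other term is
   the y_a y_b part. *)
assert (EGam0 : Gam0 d a b y = 2 * kappa d * kron a b * (R0 * Rpower t (- nu))
    + 4 * kappa d * nu * (y a * y b) * (R0 * r * Rpower t (- nu - 1))).
{ unfold Gam0, kappa; rewrite EP, EP1; unfold nu, order.
  generalize (omega_pos d) (pow_lt _ (d - 2) Hv) (pow_lt _ d Hv); intros.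
  field; lra. }
unfold Csub, Cadd, Copp, Cscal, Cmul, RtoC, Cre, Cim in *; simpl fst in *; simpl snd in *.
f_equal.
- rewrite EGam0, Hre', EG0; field; lra.
- rewrite Him'; field; lra.
Qed.

Lemma gradDiffNorm_profile x : 0 < sqnorm d x -> r * sqnorm d x < 1 ->
  gradDiffNorm d r tau x <= sqrt (2 * INR d ^ 3) * (22 * K) * r / vnorm d x ^ (d - 3).
Proof.
intros Hs Hx1.
assert (Hx : 0 < r * sqnorm d x < 1) by nra.
assert (Hv : 0 < vnorm d x) by (apply sqrt_lt_R0; exact Hs).
destruct He as (HK & e1 & e2 & e3 & (De & De1 & De2) & _ & Be & _ & _).
destruct Hf as (_ & f1 & f2 & f3 & (Df & Df1 & Df2) & _ & Bf & _ & _).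
destruct Hre as (_ & g1 & g2 & g3 & (Dg & Dg1 & Dg2) & _ & _ & Bg2 & Bg3).
destruct Him as (_ & h1 & h2 & h3 & (Dh & Dh1 & Dh2) & _ & _ & Bh2 & Bh3).
specialize (Be (le_n _)); specialize (Bf (le_n _)); specialize (Bg2 (le_n _)); specialize (Bh2 (le_n _)).
replace (1 - nu - 1) with (- nu) in Be, Bf by ring.
replace (2 - nu - 2) with (- nu) in Bg2, Bh2 by ring.
replace (2 - nu - 3) with (- nu - 1) in Bg3, Bh3 by ring.
assert (Eg1 : forall t, 0 < t < 1 ->
  g1 t = cos tau * e1 t + sin tau * f1 t - kappa d * Rpower t (- nu)).
{ apply (derives_unique _ _ _ Dg).
  apply derives_minus; [apply derives_plus; now apply derives_scal|].
  apply derives_power_primitive. }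
assert (Eg2 : forall t, 0 < t < 1 ->
  g2 t = cos tau * e2 t + sin tau * f2 t + kappa d * nu * Rpower t (- nu - 1)).
{ apply (derives_unique _ _ _ Dg1).
  apply derives_ext with (fun t => (cos tau * e1 t + sin tau * f1 t) + (- kappa d) * Rpower t (- nu)).
  - intros t Ht; rewrite Eg1 by exact Ht; ring.
  - apply derives_plus; [apply derives_plus; now apply derives_scal|].
    intros t Ht; replace (kappa d * nu * Rpower t (- nu - 1))
      with (- kappa d * (- nu * Rpower t (- nu - 1))) by ring.
    apply (is_derive_scal (fun t => Rpower t (- nu)) t).
    apply is_derive_Reals, derivable_pt_lim_power; lra. }
assert (Eh1 : forall t, 0 < t < 1 -> h1 t = cos tau * f1 t - sin tau * e1 t).
{ apply (derives_unique _ _ _ Dh); apply derives_minus; now apply derives_scal. }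
assert (Eh2 : forall t, 0 < t < 1 -> h2 t = cos tau * f2 t - sin tau * e2 t).
{ apply (derives_unique _ _ _ Dh1).
  apply derives_ext with (fun t => cos tau * f1 t - sin tau * e1 t).
  - intros t Ht; now rewrite Eh1.
  - apply derives_minus; now apply derives_scal. }
assert (EB : 22 * K * r * vnorm d x * (R0 * Rpower (r * sqnorm d x) (- nu))
             = 22 * K * r / vnorm d x ^ (d - 3)).
{ unfold R0, nu; rewrite Rpower_scaling by (trivial; lia).
  replace (d - 2)%nat with (S (d - 3)) by lia; simpl.
  generalize (pow_lt _ (d - 3) Hv); intros; field; lra. }
replace (sqrt (2 * INR d ^ 3) * (22 * K) * r / vnorm d x ^ (d - 3))
  with (sqrt (2 * INR d ^ 3) * (22 * K * r / vnorm d x ^ (d - 3)))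
  by (generalize (pow_lt _ (d - 3) Hv); intros; field; lra).
rewrite <- EB.
assert (HR0 : 0 < R0) by apply Rpower_pos.
apply gradDiffNorm_le.
{ repeat apply Rmult_le_pos; try lra; left; apply Rpower_pos. }
intros a b c Ha Hb Hc g.
split.
- change (Cre g) with (pdR (fun y => Cre (Csub (Gam d r tau a b y) (RtoC (Gam0 d a b y)))) c x).
  apply (entry_bound d r K nu R0 e e1 g1 g2 g3) with (a := a) (b := b); trivial; try lra.
  intros y Hy; rewrite (Gam_diff e1 e2 f1 f2) by trivial; simpl.
  now rewrite Eg1, Eg2.
- change (Cim g) with (pdR (fun y => Cim (Csub (Gam d r tau a b y) (RtoC (Gam0 d a b y)))) c x).
  apply (entry_bound d r K nu R0 f f1 h1 h2 h3) with (a := a) (b := b); trivial; try lra.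
  intros y Hy; rewrite (Gam_diff e1 e2 f1 f2) by trivial; simpl.
  now rewrite Eh1, Eh2.
Qed.
End Gradient.

(** * Complex numbers and power series *)

Lemma C_eq (z w : C) : Cre z = Cre w -> Cim z = Cim w -> z = w.
Proof. destruct z, w; unfold Cre, Cim; simpl; congruence. Qed.

Ltac complex_ring :=
  apply C_eq; unfold Csub, Cadd, Copp, Cmul, Cscal, RtoC, Ci, Cre, Cim; simpl fst; simpl snd.

Definition cis (x : R) : C := (cos x, sin x).

Lemma cis_add x y : Cmul (cis x) (cis y) = cis (x + y).
Proof. unfold cis; complex_ring; [rewrite cos_plus|rewrite sin_plus]; ring. Qed.

Lemma cis_0 : cis 0 = RtoC 1.
Proof. unfold cis; now rewrite cos_0, sin_0. Qed.

Lemma Cmul_scal a b z w : Cmul (Cscal a z) (Cscal b w) = Cscal (a * b) (Cmul z w).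
Proof. complex_ring; ring. Qed.

Lemma Cscal_scal a b z : Cscal a (Cscal b z) = Cscal (a * b) z.
Proof. complex_ring; ring. Qed.

Lemma Cpow_polar a x n : Cpow (Cscal a (cis x)) n = Cscal (a ^ n) (cis (INR n * x)).
Proof.
induction n as [|n IH].
- simpl; rewrite Rmult_0_l, cis_0; complex_ring; ring.
- change (Cpow (Cscal a (cis x)) (S n)) with (Cmul (Cscal a (cis x)) (Cpow (Cscal a (cis x)) n)).
  rewrite IH, Cmul_scal, cis_add, S_INR; f_equal; f_equal; ring.
Qed.

Lemma cos_sin_sq x : cos x ^ 2 + sin x ^ 2 = 1.
Proof. generalize (sin2_cos2 x); unfold Rsqr; lra. Qed.

Lemma Cinv_polar a x : a <> 0 -> Cinv (Cscal a (cis x)) = Cscal (/ a) (cis (- x)).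
Proof.
intros Ha; unfold Cinv.
assert (E : Cre (Cscal a (cis x)) ^ 2 + Cim (Cscal a (cis x)) ^ 2 = a ^ 2).
{ unfold Cscal, cis, Cre, Cim; simpl fst; simpl snd.
  replace (a ^ 2) with (a ^ 2 * (cos x ^ 2 + sin x ^ 2)); [ring|]; rewrite cos_sin_sq; ring. }
rewrite E; unfold cis; rewrite cos_neg, sin_neg.
complex_ring; field; exact Ha.
Qed.

Lemma Cmod_polar a x : 0 < a -> Cmod (Cscal a (cis x)) = a.
Proof.
intros Ha; unfold Cmod, Cscal, cis, Cre, Cim; simpl fst; simpl snd.
replace ((a * cos x) ^ 2 + (a * sin x) ^ 2) with (a ^ 2 * (cos x ^ 2 + sin x ^ 2)) by ring.
rewrite cos_sin_sq, Rmult_1_r; apply sqrt_pow2; lra.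
Qed.

(** In the upper half plane [Carg] is the arccosine of the cosine, which returns x on (0, PI). The
    argument (PI + tau) / 2 of k lies there when |tau| < PI. *)
Lemma Clog_polar a x : 0 < a -> 0 < x < PI -> Clog (Cscal a (cis x)) = (ln a, x).
Proof.
intros Ha Hx; unfold Clog, Carg; rewrite Cmod_polar by exact Ha.
unfold Cscal, cis, Cre, Cim; simpl fst; simpl snd.
destruct (Rlt_dec 0 (a * sin x)) as [_|H].
- replace (a * cos x / a) with (cos x) by (field; lra).
  rewrite acos_cos by lra; reflexivity.
- exfalso; apply H; apply Rmult_lt_0_compat; [exact Ha|now apply sin_gt_0].
Qed.

Lemma Cpowr_polar a x p : 0 < a -> 0 < x < PI ->
  Cpowr (Cscal a (cis x)) p = Cscal (Rpower a p) (cis (p * x)).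
Proof.
intros Ha Hx; unfold Cpowr; rewrite Clog_polar, Cmod_polar by trivial.
destruct (Req_EM_T a 0); [lra|].
unfold Cexp, Cscal, cis, Cre, Cim; simpl fst; simpl snd; reflexivity.
Qed.

(** This norm is submultiplicative without square roots and bounds both components directly; the
    price is a bound 2, not 1, for phases. *)
Definition norm1 (z : C) : R := Rabs (Cre z) + Rabs (Cim z).

Lemma norm1_nonneg z : 0 <= norm1 z.
Proof. generalize (Rabs_pos (Cre z)) (Rabs_pos (Cim z)); unfold norm1; lra. Qed.

Lemma norm1_mul z w : norm1 (Cmul z w) <= norm1 z * norm1 w.
Proof.
unfold norm1, Cmul; destruct z as [a b], w as [c d]; unfold Cre, Cim; simpl fst; simpl snd.
unfold Rminus; assert (H1 := Rabs_triang (a * c) (- (b * d))).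
assert (H2 := Rabs_triang (a * d) (b * c)).
rewrite Rabs_Ropp, !Rabs_mult in H1; rewrite !Rabs_mult in H2; lra.
Qed.

Lemma norm1_add z w : norm1 (Cadd z w) <= norm1 z + norm1 w.
Proof.
unfold norm1, Cadd; destruct z as [a b], w as [c d]; unfold Cre, Cim; simpl fst; simpl snd.
generalize (Rabs_triang a c) (Rabs_triang b d); lra.
Qed.

Lemma norm1_scal a z : norm1 (Cscal a z) = Rabs a * norm1 z.
Proof. unfold norm1, Cscal, Cre, Cim; simpl; rewrite !Rabs_mult; ring. Qed.

Lemma norm1_cis x : norm1 (cis x) <= 2.
Proof.
unfold norm1, cis, Cre, Cim; simpl.
assert (H1 := Rabs_le _ 1 (COS_bound x)); assert (H2 := Rabs_le _ 1 (SIN_bound x)); lra.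
Qed.

Definition CPSeries (a : nat -> C) (t : R) : C :=
  (PSeries (fun m => Cre (a m)) t, PSeries (fun m => Cim (a m)) t).

Definition cexp_bounded (M : R) (a : nat -> C) : Prop :=
  forall m, norm1 (a m) <= M / INR (fact m).

Lemma cexp_bounded_re M a : cexp_bounded M a -> exp_bounded M (fun m => Cre (a m)).
Proof.
intros H m; generalize (H m) (Rabs_pos (Cim (a m))); unfold norm1; lra.
Qed.

Lemma cexp_bounded_im M a : cexp_bounded M a -> exp_bounded M (fun m => Cim (a m)).
Proof.
intros H m; generalize (H m) (Rabs_pos (Cre (a m))); unfold norm1; lra.
Qed.

Lemma cexp_bounded_mul M N z a : norm1 z <= N -> cexp_bounded M a ->
  cexp_bounded (N * M) (fun m => Cmul z (a m)).
Proof.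
intros Hz H m; apply Rle_trans with (1 := norm1_mul _ _).
unfold Rdiv; rewrite Rmult_assoc; apply Rmult_le_compat; try apply norm1_nonneg; [exact Hz|apply H].
Qed.

Lemma cexp_bounded_add M N a b : cexp_bounded M a -> cexp_bounded N b ->
  cexp_bounded (M + N) (fun m => Cadd (a m) (b m)).
Proof.
intros Ha Hb m; apply Rle_trans with (1 := norm1_add _ _).
unfold Rdiv; rewrite Rmult_plus_distr_r; apply Rplus_le_compat; [apply Ha|apply Hb].
Qed.

Lemma cexp_bounded_le M N a : M <= N -> cexp_bounded M a -> cexp_bounded N a.
Proof.
intros HM H m; apply Rle_trans with (1 := H m).
apply Rmult_le_compat_r; [|exact HM].
left; apply Rinv_0_lt_compat, INR_fact_lt_0.
Qed.

Lemma CPSeries_add M N a b t : cexp_bounded M a -> cexp_bounded N b -> 0 < t < 1 ->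
  CPSeries (fun m => Cadd (a m) (b m)) t = Cadd (CPSeries a t) (CPSeries b t).
Proof.
intros Ha Hb Ht; apply C_eq.
- apply (PSeries_plus (fun m => Cre (a m)) (fun m => Cre (b m)));
    eapply ex_exp_bounded; eauto using cexp_bounded_re.
- apply (PSeries_plus (fun m => Cim (a m)) (fun m => Cim (b m)));
    eapply ex_exp_bounded; eauto using cexp_bounded_im.
Qed.

Lemma PSeries_lin2 M a b x y t : exp_bounded M a -> exp_bounded M b -> 0 < t < 1 ->
  PSeries (fun m => x * a m + y * b m) t = x * PSeries a t + y * PSeries b t.
Proof.
intros Ha Hb Ht.
rewrite <- !PSeries_scal, <- PSeries_plus; [reflexivity| |];
  apply ex_pseries_scal; try (intros; apply Rmult_comm);
  eapply ex_exp_bounded; eassumption.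
Qed.

Lemma CPSeries_mul M z a t : cexp_bounded M a -> 0 < t < 1 ->
  CPSeries (fun m => Cmul z (a m)) t = Cmul z (CPSeries a t).
Proof.
intros Ha Ht.
assert (H1 := cexp_bounded_re _ _ Ha); assert (H2 := cexp_bounded_im _ _ Ha).
set (x := PSeries (fun m => Cre (a m)) t); set (y := PSeries (fun m => Cim (a m)) t).
apply C_eq.
- change (PSeries (fun m => Cre (Cmul z (a m))) t = Cre z * x - Cim z * y).
  rewrite <- (PSeries_ext (fun m => Cre z * Cre (a m) + (- Cim z) * Cim (a m))).
  + rewrite (PSeries_lin2 M) by trivial; unfold x, y; ring.
  + intros m; unfold Cmul, Cre, Cim; simpl; ring.
- change (PSeries (fun m => Cim (Cmul z (a m))) t = Cre z * y + Cim z * x).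
  rewrite <- (PSeries_ext (fun m => Cre z * Cim (a m) + Cim z * Cre (a m))).
  + rewrite (PSeries_lin2 M) by trivial; unfold x, y; ring.
  + intros m; unfold Cmul, Cre, Cim; simpl; ring.
Qed.

Lemma epsilon_infinite_sum a l : infinite_sum a l ->
  epsilon (inhabits 0) (fun l => infinite_sum a l) = l.
Proof.
intros H; apply (uniqueness_sum a); [|exact H].
apply (epsilon_spec (inhabits 0) (fun l => infinite_sum a l)); now exists l.
Qed.

(** [Cseries] chooses its value by [epsilon]; the factorial bound supplies the convergence that
    determines it. *)
Lemma Cseries_CPSeries M (f a : nat -> C) t : cexp_bounded M a -> 0 < t < 1 ->
  (forall m, f m = Cscal (t ^ m) (a m)) -> Cseries f = CPSeries a t.
Proof.
intros Ha Ht Hf.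
assert (K : forall (b g : nat -> R), exp_bounded M b -> (forall m, g m = b m * t ^ m) ->
  epsilon (inhabits 0) (fun l => infinite_sum g l) = PSeries b t).
{ intros b g Hb Hg; apply epsilon_infinite_sum, is_series_Reals.
  apply is_series_ext with (fun m => b m * t ^ m); [intros; now rewrite Hg|].
  apply Series_correct, ex_pseries_R; now apply ex_exp_bounded with M. }
unfold Cseries, CPSeries; f_equal; apply K.
- now apply cexp_bounded_re.
- intros m; rewrite Hf; unfold Cscal, Cre; simpl; ring.
- now apply cexp_bounded_im.
- intros m; rewrite Hf; unfold Cscal, Cim; simpl; ring.
Qed.

Lemma Csum_S f n : Csum f (S n) = Cadd (Csum f n) (f n).
Proof.
unfold Csum; rewrite seq_S, map_app, fold_right_app; simpl.
generalize (f n); intros c.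
induction (map f (seq 0 n)) as [|x l IH]; simpl; [complex_ring; ring|].
rewrite IH; complex_ring; ring.
Qed.

(** The finite principal part of Y_n thus becomes a series, and even and odd dimensions share one
    form of [W]. *)
Lemma Csum_CPSeries M (f a : nat -> C) n t : cexp_bounded M a -> 0 < t < 1 ->
  (forall m, (m < n)%nat -> f m = Cscal (t ^ m) (a m)) ->
  (forall m, (n <= m)%nat -> a m = RtoC 0) -> Csum f n = CPSeries a t.
Proof.
intros Ha Ht Hf H0.
assert (K : forall b, exp_bounded M b -> (forall m, (n <= m)%nat -> b m = 0) ->
  PSeries b t = match n with O => 0 | S k => sum_f_R0 (fun m => b m * t ^ m) k end).
{ intros b Hb Hz; destruct n as [|k].
  - apply PSeries_zero; intros; apply Hz; lia.
  - rewrite (PSeries_decr_n _ k) by (now apply ex_exp_bounded with M).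
    rewrite PSeries_zero; [ring|].
    intros m; unfold PS_decr_n; apply Hz; lia. }
unfold CPSeries; rewrite !K.
2: now apply cexp_bounded_im.
2: intros m Hm; now rewrite H0.
2: now apply cexp_bounded_re.
2: intros m Hm; now rewrite H0.
clear K H0; destruct n as [|k]; [reflexivity|].
induction k as [|k IH].
- rewrite Csum_S, Hf by lia; unfold Csum; complex_ring; simpl; ring.
- rewrite Csum_S, IH, Hf by auto; complex_ring; simpl; ring.
Qed.

(** * Bessel functions at half-integer and integer order *)

(** The factor (m + 1) / 2 of the recursion is below 1 only at m = 0, where [sqrt PI >= 1] leaves
    room for it. *)
Lemma gh_ge_half n : 1 / 2 <= gh n.
Proof.
assert (HP : 1 <= sqrt PI) by (rewrite <- sqrt_1; apply sqrt_le_1_alt; generalize PI2_1; lra).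
enough (G : forall n, 1 / 2 <= gh n /\ 1 / 2 <= gh (S n)) by apply G.
clear n; induction n as [|n [IH1 IH2]]; [simpl; lra|].
split; [exact IH2|].
destruct n as [|n]; [simpl; lra|].
change (gh (S (S (S n)))) with ((INR (S n) + 1) / 2 * gh (S n)).
rewrite S_INR; generalize (pos_INR n); intros; nra.
Qed.

Lemma Rabs_eventually_bounded (f : nat -> R) B N : (forall m, (N <= m)%nat -> Rabs (f m) <= B) ->
  exists B', 0 <= B' /\ forall m, Rabs (f m) <= B'.
Proof.
revert B; induction N as [|N IH]; intros B H.
- exists B; split; [|intros m; apply H; lia].
  apply Rle_trans with (1 := Rabs_pos (f O)); apply H; lia.
- apply (IH (Rmax B (Rabs (f N)))).
  intros m Hm; destruct (Nat.eq_dec m N) as [->|E]; [apply Rmax_r|].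
  apply Rle_trans with (2 := Rmax_l _ _); apply H; lia.
Qed.

(** Nonpositive arguments occur for finitely many m only; beyond them [gh_ge_half] applies. *)
Lemma rgamma_half_bounded (s : Z) :
  exists B, 0 <= B /\ forall m, Rabs (rgamma_half (2 * Z.of_nat m + s)) <= B.
Proof.
apply Rabs_eventually_bounded with (B := 2) (N := S (Z.to_nat (- s))).
intros m Hm; unfold rgamma_half.
replace (Z.leb 1 (2 * Z.of_nat m + s)) with true by (symmetry; apply Z.leb_le; lia).
generalize (gh_ge_half (Z.to_nat (2 * Z.of_nat m + s - 1))); intros H.
rewrite Rabs_pos_eq by (left; apply Rinv_0_lt_compat; lra).
replace 2 with (/ (1 / 2)) by field; apply Rinv_le_contravar; lra.
Qed.

Lemma rgamma_half_rgn j : rgamma_half (1 - 2 * Z.of_nat j) = rgn j.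
Proof.
unfold rgamma_half; destruct j as [|j]; [reflexivity|].
replace (Z.leb 1 (1 - 2 * Z.of_nat (S j))) with false by (symmetry; apply Z.leb_gt; lia).
replace (Z.even (1 - 2 * Z.of_nat (S j))) with false.
- f_equal; replace (1 - (1 - 2 * Z.of_nat (S j)))%Z with (Z.of_nat (S j) * 2)%Z by ring.
  rewrite Z.div_mul by lia; apply Nat2Z.id.
- replace (1 - 2 * Z.of_nat (S j))%Z with (1 + 2 * (- Z.of_nat (S j)))%Z by ring.
  now rewrite Z.even_add_mul_2.
Qed.

Lemma sqrt_PI_pos : 0 < sqrt PI.
Proof. apply sqrt_lt_R0, PI_RGT_0. Qed.

(** This is 1 / Gamma(z) = z / Gamma(z + 1) at z = 1/2 - j; it links [W 1] to [W 0] in odd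
    dimensions. *)
Lemma rgamma_half_step j :
  (1 / 2 - INR j) * rgamma_half (3 - 2 * Z.of_nat j) = rgn j.
Proof.
destruct j as [|j].
- change (rgamma_half (3 - 2 * Z.of_nat 0)) with (/ ((0 + 1) / 2 * sqrt PI)); simpl.
  generalize sqrt_PI_pos; intros; field; lra.
- replace (3 - 2 * Z.of_nat (S j))%Z with (1 - 2 * Z.of_nat j)%Z by lia.
  rewrite rgamma_half_rgn, S_INR; simpl; f_equal; field.
Qed.

(* The reflection formula for the Gamma function at half-integers. *)
Lemma rgn_gh j : rgn j = (-1) ^ j * gh (2 * j) / PI.
Proof.
generalize PI_RGT_0; intros HP; induction j as [|j IH].
- assert (HS := sqrt_PI_pos); simpl.
  apply Rmult_eq_reg_l with (sqrt PI * PI); [|nra].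
  replace (sqrt PI * PI * / sqrt PI) with PI by (field; lra).
  replace (sqrt PI * PI * (1 * sqrt PI / PI)) with (sqrt PI * sqrt PI) by (field; lra).
  symmetry; apply sqrt_sqrt; lra.
- replace (2 * S j)%nat with (S (S (2 * j))) by lia.
  change (gh (S (S (2 * j)))) with ((INR (2 * j) + 1) / 2 * gh (2 * j)).
  change (rgn (S j)) with ((- INR j - 1 / 2) * rgn j).
  rewrite IH, mult_INR; simpl; field; lra.
Qed.

Lemma gh_fact n : gh (2 * n + 1) = INR (fact n).
Proof.
induction n as [|n IH]; [reflexivity|].
replace (2 * S n + 1)%nat with (S (S (2 * n + 1))) by lia.
change (gh (S (S (2 * n + 1)))) with ((INR (2 * n + 1) + 1) / 2 * gh (2 * n + 1)).
rewrite IH, plus_INR, mult_INR; change (fact (S n)) with (S n * fact n)%nat.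
rewrite mult_INR, (S_INR n); simpl; field.
Qed.

Lemma cos_sin_half_integer j :
  cos ((INR j + 1 / 2) * PI) = 0 /\ sin ((INR j + 1 / 2) * PI) = (-1) ^ j.
Proof.
induction j as [|j [IH1 IH2]].
- simpl; replace ((0 + 1 / 2) * PI) with (PI / 2) by field.
  now rewrite cos_PI2, sin_PI2.
- rewrite S_INR; replace ((INR j + 1 + 1 / 2) * PI) with ((INR j + 1 / 2) * PI + PI) by ring.
  rewrite neg_cos, neg_sin, IH1, IH2; simpl; split; ring.
Qed.

(* [t ^ m * bessel_coef s x m] is the [m]-th term of the series of J at [t ^ (1/2) * cis x]. *)
Definition bessel_coef (s : Z) (x : R) (m : nat) : C :=
  Cscal ((-1) ^ m / INR (fact m) * rgamma_half (2 * Z.of_nat m + s + 2) * / 4 ^ m)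
        (cis (2 * INR m * x)).

Lemma inv_pow4_le m : 0 < / 4 ^ m <= 1.
Proof.
assert (H := pow_R1_Rle 4 m ltac:(lra)).
split; [apply Rinv_0_lt_compat; lra|].
rewrite <- Rinv_1; apply Rinv_le_contravar; lra.
Qed.

Lemma Rabs_pow_m1 m : Rabs ((-1) ^ m) = 1.
Proof. apply pow_1_abs. Qed.

Lemma scal_cis_bounded B c x m : Rabs c <= B -> 
  norm1 (Cscal (c / INR (fact m) * / 4 ^ m) (cis x)) <= 2 * B / INR (fact m).
Proof.
intros H; rewrite norm1_scal.
assert (Hf := Rinv_0_lt_compat _ (INR_fact_lt_0 m)).
unfold Rdiv; rewrite !Rabs_mult, (Rabs_pos_eq (/ INR (fact m))), (Rabs_pos_eq (/ 4 ^ m))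
  by (left; apply inv_pow4_le || exact Hf).
generalize (norm1_cis x) (norm1_nonneg (cis x)) (inv_pow4_le m) (Rabs_pos c); intros H1 H2 H3 H4.
assert (H5 : / 4 ^ m * norm1 (cis x) <= 2) by nra.
assert (H6 : 0 <= / 4 ^ m * norm1 (cis x)) by nra.
assert (H7 : Rabs c * (/ 4 ^ m * norm1 (cis x)) <= B * 2) by (apply Rmult_le_compat; lra).
apply Rle_trans with (Rabs c * (/ 4 ^ m * norm1 (cis x)) * / INR (fact m)); [right; ring|].
apply Rmult_le_compat_r; lra.
Qed.

Lemma bessel_coef_bounded s : exists M, 0 <= M /\ forall x, cexp_bounded M (bessel_coef s x).
Proof.
destruct (rgamma_half_bounded (s + 2)) as (B & HB & H).
exists (2 * B); split; [lra|]; intros x m; unfold bessel_coef.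
replace ((-1) ^ m / INR (fact m) * rgamma_half (2 * Z.of_nat m + s + 2) * / 4 ^ m)
  with (((-1) ^ m * rgamma_half (2 * Z.of_nat m + s + 2)) / INR (fact m) * / 4 ^ m)
  by (unfold Rdiv; ring).
apply scal_cis_bounded; rewrite Rabs_mult, Rabs_pow_m1, Rmult_1_l.
rewrite <- Z.add_assoc; apply H.
Qed.

Lemma half_pow q m : (q / 2) ^ (2 * m) = (q ^ 2) ^ m * / 4 ^ m.
Proof.
rewrite pow_mult, <- pow_inv, <- Rpow_mult_distr; f_equal; field.
Qed.

Lemma BesselJ_polar s M q x : cexp_bounded M (bessel_coef s x) -> 0 < q < 1 -> 0 < x < PI ->
  BesselJ s (Cscal q (cis x)) =
  Cscal (Rpower (q / 2) (nu_of s)) (Cmul (cis (nu_of s * x)) (CPSeries (bessel_coef s x) (q ^ 2))).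
Proof.
intros HM Hq Hx; unfold BesselJ.
rewrite Cscal_scal; replace (/ 2 * q) with (q / 2) by field.
rewrite Cpowr_polar by (trivial; lra).
rewrite (Cseries_CPSeries M _ (bessel_coef s x) (q ^ 2)); trivial.
- complex_ring; ring.
- simpl; nra.
- intros m; rewrite Cpow_polar, half_pow, mult_INR.
  unfold bessel_coef; rewrite !Cscal_scal; f_equal; simpl; ring.
Qed.

(** * The kernel G as a function of t *)

Definition gl_const (d : nat) : R := / (4 * Rpower (2 * PI) (order d)).

Lemma Gl_polar d r tau y : (2 <= d)%nat -> 0 < r -> 0 < r * sqnorm d y -> Rabs tau < PI ->
  let t := r * sqnorm d y in
  let x := (PI + tau) / 2 in
  Gl d r tau y =
  Cmul (Cscal (gl_const d * (Rpower r (order d) * Rpower t (- order d))) Ci)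
    (Cmul (Cscal (Rpower (sqrt t) (order d)) (cis (order d * x)))
       (Hankel1 (Z.of_nat d - 2) (Cscal (sqrt t) (cis x)))).
Proof.
intros Hd Hr Ht Htau t x.
assert (Hs : 0 < sqnorm d y) by nra.
assert (Hx : 0 < x < PI) by (unfold x; apply Rabs_def2 in Htau; lra).
assert (Hq : 0 < sqrt t) by (apply sqrt_lt_R0; exact Ht).
assert (Ez : Cscal (vnorm d y) (kk r tau) = Cscal (sqrt t) (cis x)).
{ unfold t; rewrite sqrt_mult by lra.
  change (sqrt (sqnorm d y)) with (vnorm d y).
  unfold kk, cis; fold x; complex_ring; ring. }
unfold Gl; rewrite Ez.
replace (INR d / 2 - 1) with (order d) by (unfold order; field).
rewrite Cpowr_polar by trivial.
do 2 f_equal; unfold gl_const; f_equal.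
symmetry; now apply Rpower_scaling.
Qed.

(** The factor z^nu of G meets (z/2)^nu from J_nu: the result t^nu cancels the prefactor t^(-nu),
    and J_nu lands in the regular part. With (z/2)^(-nu), as in [Rpower_sqrt_half_opp], the
    prefactor survives and the term is singular. *)
Lemma Rpower_sqrt_half t p : 0 < t ->
  Rpower (sqrt t) p * Rpower (sqrt t / 2) p = Rpower t p * Rpower 2 (- p).
Proof.
intros Ht; assert (Hq := sqrt_lt_R0 t Ht).
assert (E2 : Rpower (/ 2) p = Rpower 2 (- p)).
{ unfold Rpower; rewrite ln_Rinv by lra; f_equal; ring. }
assert (Et : Rpower t p = Rpower (sqrt t) p * Rpower (sqrt t) p).
{ rewrite Rpower_mult_distr, sqrt_sqrt by lra; reflexivity. }
unfold Rdiv; rewrite <- (Rpower_mult_distr (sqrt t) (/ 2)), E2, Et by lra; ring.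
Qed.

Lemma Rpower_sqrt_half_opp t p : 0 < t ->
  Rpower (sqrt t) p * Rpower (sqrt t / 2) (- p) = Rpower 2 p.
Proof.
intros Ht; assert (Hq := sqrt_lt_R0 t Ht).
replace (sqrt t) with (sqrt t / 2 * 2) at 1 by field.
rewrite <- Rpower_mult_distr by lra.
rewrite Rmult_comm, <- Rmult_assoc, <- Rpower_plus, Rplus_opp_l, Rpower_O by lra; ring.
Qed.

(* [W 0] is matched with the Laplace kernel [G0]; [W 1], or [V 0] when [nu = 1], is matched with
   the Stokes kernel [Gam0] through the second derivatives of [power_primitive nu (kappa d)]. *)
Definition kernel_expansion (d : nat) (M tau : R) : Prop :=
  let nu := order d in
  exists U V W : nat -> C,
  (cexp_bounded M U /\ cexp_bounded M V /\ cexp_bounded M W) /\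
  W 0%nat = RtoC (4 * kappa d) /\
  (nu = 1 \/ 2 <= nu \/ (forall m, V m = RtoC 0)) /\
  (nu = 1 -> W 1%nat = RtoC 0 /\ Cmul (cis (- tau)) (V 0%nat) = RtoC (kappa d)) /\
  (nu <> 1 -> Cscal (1 - nu) (Cmul (cis (- tau)) (W 1%nat)) = RtoC (kappa d)) /\
  forall r y, 0 < r -> 0 < r * sqnorm d y < 1 ->
  let t := r * sqnorm d y in
  Gl d r tau y = Cscal (Rpower r nu)
    (Cadd (Cadd (CPSeries U t) (Cscal (ln t) (CPSeries V t)))
          (Cscal (Rpower t (- nu)) (CPSeries W t))).

Lemma gl_const_value d : gl_const d * Rpower 2 (order d) = / (4 * Rpower PI (order d)).
Proof.
generalize PI_RGT_0; intros HP; unfold gl_const.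
rewrite <- Rpower_mult_distr by lra.
generalize (Rpower_pos 2 (order d)) (Rpower_pos PI (order d)); intros; field; lra.
Qed.

Lemma kappa_value d : (3 <= d)%nat ->
  4 * kappa d = gh (d - 1) / (4 * order d * Rpower PI (order d) * PI).
Proof.
intros Hd; generalize PI_RGT_0; intros HP; unfold kappa, omega.
replace (INR d / 2) with (order d + 1) by (unfold order; field).
rewrite Rpower_succ by lra.
replace (INR d - 2) with (2 * order d) by (unfold order; field).
assert (0 < order d) by (generalize (le_INR 3 d Hd); simpl; unfold order; lra).
generalize (gh_ge_half (d - 1)) (Rpower_pos PI (order d)); intros; field; lra.
Qed.

(** The identity k^2 = -lambda, read on phases; it makes the rotated coefficient after [W 0]
    real. *)
Lemma cis_opp_tau tau : Cmul (cis (- tau)) (cis (2 * 1 * ((PI + tau) / 2))) = RtoC (-1).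
Proof.
rewrite cis_add; replace (- tau + 2 * 1 * ((PI + tau) / 2)) with PI by field.
unfold cis; now rewrite cos_PI, sin_PI.
Qed.

(** * Odd dimensions: half-integer order *)

Lemma order_odd j : order (2 * j + 3) = INR j + 1 / 2.
Proof. unfold order; rewrite plus_INR, mult_INR; simpl; field. Qed.

Lemma nu_of_odd j : nu_of (Z.of_nat (2 * j + 3) - 2) = INR j + 1 / 2.
Proof.
unfold nu_of; rewrite minus_IZR, <- INR_IZR_INZ, plus_INR, mult_INR; simpl; field.
Qed.

Lemma cexp_bounded_RtoC_0 M : 0 <= M -> cexp_bounded M (fun _ => RtoC 0).
Proof.
intros HM m; unfold norm1, RtoC, Cre, Cim; simpl; rewrite Rabs_R0, Rplus_0_r.
apply Rmult_le_pos; [exact HM|left; apply Rinv_0_lt_compat, INR_fact_lt_0].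
Qed.

Lemma norm1_RtoC a : norm1 (RtoC a) = Rabs a.
Proof. unfold norm1, RtoC, Cre, Cim; simpl; rewrite Rabs_R0; ring. Qed.

Lemma CPSeries_RtoC_0 t : CPSeries (fun _ => RtoC 0) t = RtoC 0.
Proof.
unfold CPSeries, RtoC, Cre, Cim; simpl; now rewrite PSeries_const_0.
Qed.

(** At half-integer order cos (nu PI) = 0, so Y_nu = - J_(-nu) / sin (nu PI). Then J_nu yields [U],
    J_(-nu) yields [W], and there is no logarithm. *)
Lemma kernel_expansion_odd j : exists M, 0 <= M /\
  forall tau, Rabs tau < PI -> kernel_expansion (2 * j + 3) M tau.
Proof.
set (d := (2 * j + 3)%nat); set (nu := order d); set (s := (Z.of_nat d - 2)%Z).
destruct (bessel_coef_bounded s) as (M1 & HM1 & B1).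
destruct (bessel_coef_bounded (- s)) as (M2 & HM2 & B2).
set (c := gl_const d).
set (sn := sin (nu * PI)).
assert (Enu : nu = INR j + 1 / 2) by apply order_odd.
assert (Es : nu_of s = nu) by (rewrite Enu; apply nu_of_odd).
destruct (cos_sin_half_integer j) as (Ecos & Esin); rewrite <- Enu in Ecos, Esin; fold sn in Esin.
assert (Hsn2 : sn * sn = 1) by (rewrite Esin, <- Rpow_mult_distr; replace (-1 * -1) with 1 by ring; apply pow1).
assert (Hsn : sn <> 0) by (intros E; rewrite E in Hsn2; lra).
exists (Rabs (c * Rpower 2 (- nu)) * 4 * M1 + Rabs (c * Rpower 2 nu / sn) * M2).
assert (HA : 0 <= Rabs (c * Rpower 2 (- nu)) * 4 * M1).
{ repeat apply Rmult_le_pos; try lra; apply Rabs_pos. }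
assert (HB : 0 <= Rabs (c * Rpower 2 nu / sn) * M2).
{ repeat apply Rmult_le_pos; try lra; apply Rabs_pos. }
split; [lra|]; intros tau Htau.
set (x := (PI + tau) / 2).
assert (Hx : 0 < x < PI) by (unfold x; apply Rabs_def2 in Htau; lra).
set (z1 := Cscal (c * Rpower 2 (- nu)) (Cmul Ci (cis (2 * nu * x)))).
assert (Hz1 : norm1 z1 <= Rabs (c * Rpower 2 (- nu)) * 4).
{ unfold z1; rewrite norm1_scal; apply Rmult_le_compat_l; [apply Rabs_pos|].
  apply Rle_trans with (1 := norm1_mul _ _).
  replace (norm1 Ci) with 1; [generalize (norm1_cis (2 * nu * x)); lra|].
  unfold norm1, Ci, Cre, Cim; simpl; rewrite Rabs_R0, Rabs_R1; ring. }
(* The i in front of G, the i of the Hankel function and the sign in Y_nu multiply to 1, and the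
   phases of z^nu and z^(-nu) cancel. *)
set (z2 := RtoC (c * Rpower 2 nu / sn)).
exists (fun m => Cmul z1 (bessel_coef s x m)), (fun _ => RtoC 0),
  (fun m => Cmul z2 (bessel_coef (- s) x m)).
(* By reflection 1 / Gamma(1 - nu) = sin (nu PI) Gamma(nu) / PI; the sine cancels, and nu Gamma(nu)
   = Gamma(d/2) is the value inside [omega]. *)
assert (EW0 : c * Rpower 2 nu / sn * rgn j = 4 * kappa d).
{ unfold c, nu; rewrite gl_const_value, kappa_value by (unfold d; lia); fold nu.
  replace (d - 1)%nat with (S (S (2 * j))) by (unfold d; lia).
  change (gh (S (S (2 * j)))) with ((INR (2 * j) + 1) / 2 * gh (2 * j)).
  rewrite rgn_gh, <- Esin, mult_INR, Enu.
  generalize PI_RGT_0 (Rpower_pos PI (INR j + 1 / 2)) (pos_INR j); intros; simpl; field.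
  repeat split; lra. }
assert (Hj : (Z.of_nat d = 2 * Z.of_nat j + 3)%Z) by (unfold d; lia).
split; [|split; [|split; [|split; [|split]]]].
- split; [|split].
  + apply cexp_bounded_le with (Rabs (c * Rpower 2 (- nu)) * 4 * M1); [lra|].
    now apply cexp_bounded_mul.
  + apply cexp_bounded_RtoC_0; lra.
  + apply cexp_bounded_le with (Rabs (c * Rpower 2 nu / sn) * M2); [lra|].
    apply cexp_bounded_mul; trivial; unfold z2; rewrite norm1_RtoC; lra.
- unfold z2, bessel_coef.
  replace (2 * Z.of_nat 0 + - s + 2)%Z with (1 - 2 * Z.of_nat j)%Z by (unfold s; lia).
  rewrite rgamma_half_rgn, <- EW0.
  replace (2 * INR 0 * x) with 0 by (simpl; ring); rewrite cis_0.
  complex_ring; simpl; field; trivial.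
- right; right; reflexivity.
- intros E; fold nu in E; exfalso; rewrite Enu in E.
  assert (E' : INR (2 * j) = INR 1) by (rewrite mult_INR; simpl; lra).
  apply INR_eq in E'; lia.
- intros _; fold nu; unfold z2, bessel_coef.
  replace (2 * Z.of_nat 1 + - s + 2)%Z with (3 - 2 * Z.of_nat j)%Z by (unfold s; lia).
  change (INR 1) with 1.
  transitivity (Cscal ((1 - nu) * (c * Rpower 2 nu / sn * (- rgamma_half (3 - 2 * Z.of_nat j) / 4)))
    (Cmul (cis (- tau)) (cis (2 * 1 * x)))).
  { complex_ring; simpl; field; trivial. }
  unfold x; rewrite cis_opp_tau.
  transitivity (RtoC (c * Rpower 2 nu / sn * ((1 / 2 - INR j) * rgamma_half (3 - 2 * Z.of_nat j)) / 4)).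
  { rewrite Enu; complex_ring; [field; trivial|ring]. }
  rewrite rgamma_half_step, EW0; f_equal; field.
- intros r y Hr Ht t; fold t in Ht.
  assert (Hq : 0 < sqrt t) by (apply sqrt_lt_R0; lra).
  assert (Hq1 : sqrt t < 1) by (rewrite <- sqrt_1; apply sqrt_lt_1_alt; lra).
  assert (Eq2 : sqrt t ^ 2 = t) by (apply pow2_sqrt; lra).
  rewrite Gl_polar by first [exact Htau | exact Hr | exact (proj1 Ht) | unfold d; lia]; fold t x; cbv zeta; fold nu c s.
  rewrite (CPSeries_mul M1), (CPSeries_mul M2), CPSeries_RtoC_0 by auto.
  unfold Hankel1, BesselY.
  replace (Z.even s) with false.
  2: { unfold s; rewrite Hj; replace (2 * Z.of_nat j + 3 - 2)%Z with (1 + 2 * Z.of_nat j)%Z by ring.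
       now rewrite Z.even_add_mul_2. }
  rewrite (BesselJ_polar s M1), (BesselJ_polar (- s) M2) by auto.
  assert (Es' : nu_of (- s) = - nu) by (rewrite <- Es; unfold nu_of; rewrite opp_IZR; field).
  rewrite Es, Es', Eq2, Ecos; fold sn.
  set (A := CPSeries (bessel_coef s x) t); set (B := CPSeries (bessel_coef (- s) x) t).
  assert (H1 := Rpower_sqrt_half t nu (proj1 Ht)).
  assert (H2 := Rpower_sqrt_half_opp t nu (proj1 Ht)).
  assert (E1 : cis (2 * nu * x) = Cmul (cis (nu * x)) (cis (nu * x))) by (rewrite cis_add; f_equal; ring).
  assert (E2 : Cmul (cis (nu * x)) (cis (- nu * x)) = RtoC 1)
    by (rewrite cis_add, <- cis_0; f_equal; ring).
  (* Powers and phases are grouped into the products evaluated by [H1], [H2], [E1] and [E2]. *)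
  transitivity (Cscal (c * Rpower r nu * Rpower t (- nu)) (Cmul Ci (Cadd
    (Cscal (Rpower (sqrt t) nu * Rpower (sqrt t / 2) nu) (Cmul (Cmul (cis (nu * x)) (cis (nu * x))) A))
    (Cmul Ci (Cscal (- / sn) (Cscal (Rpower (sqrt t) nu * Rpower (sqrt t / 2) (- nu))
      (Cmul (Cmul (cis (nu * x)) (cis (- nu * x))) B))))))).
  { generalize (cis (nu * x)) (cis (- nu * x)); intros; complex_ring; field; trivial. }
  rewrite E2, <- E1, H1, H2; unfold z1, z2.
  rewrite Rpower_Ropp with (x := t).
  generalize (Rpower_pos t nu); intros; complex_ring; field; split; trivial; lra.
Qed.

(** * Even dimensions: integer order *)

Lemma fact_ge_id k : INR k <= INR (fact k).
Proof.
apply le_INR; destruct k as [|k]; [simpl; lia|].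
generalize (lt_O_fact k); simpl; nia.
Qed.

Lemma harmonic_bound k : 0 <= harmonic k <= INR k.
Proof.
destruct k as [|k]; [simpl; lra|unfold harmonic].
assert (H : forall i, 0 < / INR (S i) <= 1).
{ intros i; split; [apply Rinv_0_lt_compat, lt_0_INR; lia|].
  rewrite <- Rinv_1; apply Rinv_le_contravar; [lra|]; apply (le_INR 1); lia. }
induction k as [|k IH]; [simpl; lra|].
rewrite tech5; generalize (H (S k)); rewrite (S_INR (S k)); intros; lra.
Qed.

(** Harmonic numbers grow at most like k <= k!, so (n + m)! absorbs the digamma values and 1 / m!
    remains for the factorial bound. *)
Lemma digamma_ratio_bound n m :
  Rabs ((digamma_succ m + digamma_succ (n + m)) / INR (fact (n + m))) <= 2 * Rabs euler_gamma + 2.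
Proof.
unfold digamma_succ.
generalize (harmonic_bound m) (harmonic_bound (n + m)) (fact_ge_id (n + m))
  (INR_fact_lt_0 (n + m)); intros H1 H2 H3 H4.
assert (H5 : INR m <= INR (n + m)) by (apply le_INR; lia).
assert (H6 : 1 <= INR (fact (n + m))) by (apply (le_INR 1), lt_O_fact).
unfold Rdiv; rewrite Rabs_mult, (Rabs_pos_eq (/ _)) by (left; now apply Rinv_0_lt_compat).
apply Rmult_le_reg_r with (INR (fact (n + m))); [exact H4|].
rewrite Rmult_assoc, Rinv_l, Rmult_1_r by lra.
apply Rabs_le; generalize (Rle_abs euler_gamma) (Rle_abs (- euler_gamma)) (Rabs_pos euler_gamma).
rewrite Rabs_Ropp; intros; nra.
Qed.

Definition digamma_coef (n : nat) (x : R) (m : nat) : C :=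
  Cscal (((-1) ^ m * ((digamma_succ m + digamma_succ (n + m)) / INR (fact (n + m))))
           / INR (fact m) * / 4 ^ m) (cis (2 * INR m * x)).

Lemma digamma_coef_bounded n x :
  cexp_bounded (2 * (2 * Rabs euler_gamma + 2)) (digamma_coef n x).
Proof.
intros m; apply scal_cis_bounded.
rewrite Rabs_mult, Rabs_pow_m1, Rmult_1_l; apply digamma_ratio_bound.
Qed.

Definition polar_coef (n : nat) (x : R) (m : nat) : C :=
  if Nat.ltb m n then Cscal (INR (fact (n - m - 1)) / INR (fact m) * / 4 ^ m) (cis (2 * INR m * x))
  else RtoC 0.

Lemma polar_coef_bounded n x : cexp_bounded (2 * INR (fact n)) (polar_coef n x).
Proof.
intros m; unfold polar_coef; destruct (Nat.ltb_spec m n) as [H|H].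
- apply scal_cis_bounded; rewrite Rabs_pos_eq by apply pos_INR.
  apply le_INR, fact_le; lia.
- apply cexp_bounded_RtoC_0; generalize (pos_INR (fact n)); lra.
Qed.

Lemma BesselY_int_polar n M q x : cexp_bounded M (bessel_coef (Z.of_nat (2 * n)) x) ->
  0 < q < 1 -> 0 < x < PI ->
  BesselY_int n (Cscal q (cis x)) =
  Cadd (Cadd
    (Cscal (- / PI * Rpower (q / 2) (- INR n)) (Cmul (cis (- INR n * x)) (CPSeries (polar_coef n x) (q ^ 2))))
    (Cscal (2 / PI * Rpower (q / 2) (INR n)) (Cmul (ln (q / 2), x)
       (Cmul (cis (INR n * x)) (CPSeries (bessel_coef (Z.of_nat (2 * n)) x) (q ^ 2))))))
    (Cscal (- / PI * Rpower (q / 2) (INR n)) (Cmul (cis (INR n * x)) (CPSeries (digamma_coef n x) (q ^ 2)))).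
Proof.
intros HM Hq Hx; unfold BesselY_int.
assert (Ht : 0 < q ^ 2 < 1) by (simpl; nra).
rewrite (BesselJ_polar _ M) by trivial.
replace (nu_of (Z.of_nat (2 * n))) with (INR n)
  by (unfold nu_of; rewrite <- INR_IZR_INZ, mult_INR; simpl; field).
rewrite Cscal_scal; replace (/ 2 * q) with (q / 2) by field.
rewrite (Cpow_polar (q / 2) x n), Cinv_polar, Clog_polar by (trivial; try lra; apply pow_nonzero; lra).
rewrite <- (Rpower_opp_nat (q / 2)), <- (Rpower_pow n (q / 2)) by lra.
replace (Cmul (Cscal (q / 2) (cis x)) (Cscal (q / 2) (cis x))) with (Cscal (q ^ 2 * / 4) (cis (2 * x))).
2: { rewrite Cmul_scal, cis_add; f_equal; [field|f_equal; ring]. }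
replace (Copp (Cscal (q ^ 2 * / 4) (cis (2 * x)))) with (Cscal (- 1 * (q ^ 2 * / 4)) (cis (2 * x)))
  by (complex_ring; ring).
rewrite (Csum_CPSeries _ _ (polar_coef n x) n (q ^ 2) (polar_coef_bounded n x)); trivial.
2: { intros m Hm; unfold polar_coef; apply Nat.ltb_lt in Hm as ->.
     rewrite Cpow_polar, !Cscal_scal, Rpow_mult_distr, pow_inv.
     f_equal; [ring|f_equal; ring]. }
2: { intros m Hm; unfold polar_coef; now apply Nat.ltb_ge in Hm as ->. }
rewrite (Cseries_CPSeries _ _ (digamma_coef n x) (q ^ 2) (digamma_coef_bounded n x)); trivial.
2: { intros m; unfold digamma_coef.
     rewrite Cpow_polar, !Cscal_scal, !Rpow_mult_distr, pow_inv.
     f_equal; [|f_equal; ring].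
     generalize (INR_fact_lt_0 m) (INR_fact_lt_0 (n + m)) (pow_lt 4 m); intros; field; lra. }
rewrite Ropp_mult_distr_l; complex_ring; ring.
Qed.

Lemma order_even n : order (2 * n + 2) = INR n.
Proof. unfold order; rewrite plus_INR, mult_INR; simpl; field. Qed.

(** The logarithm in Y_n is ln (z/2) = (1/2) ln t - ln 2 + i x. Its ln t part gives [V]; the
    constant part, J_n and the digamma series give [U]; the finite sum gives [W]. *)
Lemma kernel_expansion_even n : (1 <= n)%nat -> exists M, 0 <= M /\
  forall tau, Rabs tau < PI -> kernel_expansion (2 * n + 2) M tau.
Proof.
intros Hn; set (d := (2 * n + 2)%nat); set (nu := order d); set (s := Z.of_nat (2 * n)).
assert (Enu : nu = INR n) by apply order_even.
destruct (bessel_coef_bounded s) as (MA & HMA & BA).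
set (MP := 2 * (2 * Rabs euler_gamma + 2)).
set (MF := 2 * INR (fact n)).
set (c := gl_const d).
set (k := c * Rpower 2 (- nu)).
generalize PI_RGT_0; intros HPI.
assert (HMP : 0 <= MP) by (generalize (Rabs_pos euler_gamma); unfold MP; lra).
assert (HMF : 0 <= MF) by (generalize (pos_INR (fact n)); unfold MF; lra).
set (N1 := Rabs k * (2 * (Rabs (2 / PI * ln 2) + 1))).
set (N2 := Rabs (k / PI) * 2).
set (N3 := Rabs (c * Rpower 2 nu / PI)).
assert (HN1 : 0 <= N1).
{ unfold N1; generalize (Rabs_pos k) (Rabs_pos (2 / PI * ln 2)); intros; nra. }
assert (HN2 : 0 <= N2) by (generalize (Rabs_pos (k / PI)); unfold N2; lra).
assert (HN3 : 0 <= N3) by apply Rabs_pos.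
assert (P1 : 0 <= N1 * MA) by now apply Rmult_le_pos.
assert (P2 : 0 <= N2 * MP) by now apply Rmult_le_pos.
assert (P3 : 0 <= N2 * MA) by now apply Rmult_le_pos.
assert (P4 : 0 <= N3 * MF) by now apply Rmult_le_pos.
exists ((N1 * MA + N2 * MP) + N2 * MA + N3 * MF).
split; [lra|]; intros tau Htau.
set (x := (PI + tau) / 2).
assert (Hx : 0 < x < PI) by (unfold x; apply Rabs_def2 in Htau; lra).
set (E := cis (2 * nu * x)).
(* The pair is i - (2 / PI) (i x - ln 2): the i of J_n plus the constant part of the logarithm. As 0
   < x < PI, its imaginary part stays in [-1, 1], uniformly in tau. *)
set (z1 := Cscal k (Cmul E (2 / PI * ln 2, 1 - 2 * x / PI))).
set (z2 := Cscal (k / PI) E).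
set (z3 := Cscal (- (k / PI)) E).
set (z4 := RtoC (c * Rpower 2 nu / PI)).
assert (Hz1 : norm1 z1 <= N1).
{ unfold z1, N1; rewrite norm1_scal; apply Rmult_le_compat_l; [apply Rabs_pos|].
  apply Rle_trans with (1 := norm1_mul _ _).
  apply Rmult_le_compat; try apply norm1_nonneg; [apply norm1_cis|].
  unfold norm1, Cre, Cim; simpl fst; simpl snd; apply Rplus_le_compat_l.
  apply Rabs_le; assert (0 < x / PI < 1).
  { split; [apply Rdiv_lt_0_compat; lra|apply (Rdiv_lt_1 x PI); lra]. }
  unfold Rdiv in *; lra. }
assert (Hz2 : norm1 z2 <= N2).
{ unfold z2, N2; rewrite norm1_scal; apply Rmult_le_compat_l; [apply Rabs_pos|apply norm1_cis]. }
assert (Hz3 : norm1 z3 <= N2).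
{ unfold z3, N2; rewrite norm1_scal, Rabs_Ropp; apply Rmult_le_compat_l; [apply Rabs_pos|apply norm1_cis]. }
assert (Hz4 : norm1 z4 <= N3) by (unfold z4; rewrite norm1_RtoC; apply Rle_refl).
assert (BP := digamma_coef_bounded n x); fold MP in BP.
assert (BF := polar_coef_bounded n x); fold MF in BF.
assert (EW0 : c * Rpower 2 nu / PI * INR (fact (n - 1)) = 4 * kappa d).
{ unfold c, nu; rewrite gl_const_value, kappa_value by (unfold d; lia); fold nu; rewrite Enu.
  replace (d - 1)%nat with (2 * n + 1)%nat by (unfold d; lia); rewrite gh_fact.
  replace n with (S (n - 1)) at 3 by lia.
  change (fact (S (n - 1))) with (S (n - 1) * fact (n - 1))%nat.
  rewrite mult_INR; replace (S (n - 1)) with n by lia.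
  generalize (Rpower_pos PI (INR n)) (lt_0_INR n Hn); intros; field; lra. }
exists (fun m => Cadd (Cmul z1 (bessel_coef s x m)) (Cmul z2 (digamma_coef n x m))),
  (fun m => Cmul z3 (bessel_coef s x m)), (fun m => Cmul z4 (polar_coef n x m)).
split; [|split; [|split; [|split; [|split]]]].
- split; [|split].
  + apply cexp_bounded_le with (N1 * MA + N2 * MP); [lra|].
    apply cexp_bounded_add; now apply cexp_bounded_mul.
  + apply cexp_bounded_le with (N2 * MA); [lra|]; now apply cexp_bounded_mul.
  + apply cexp_bounded_le with (N3 * MF); [lra|]; now apply cexp_bounded_mul.
- unfold z4, polar_coef; replace (Nat.ltb 0 n) with true by (symmetry; apply Nat.ltb_lt; lia).
  rewrite <- EW0, Nat.sub_0_r.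
  replace (2 * INR 0 * x) with 0 by (simpl; ring); rewrite cis_0.
  complex_ring; simpl; field; lra.
- fold nu; rewrite Enu; destruct (Nat.eq_dec n 1) as [->|Hn1]; [now left|right; left].
  apply (le_INR 2); lia.
- fold nu; rewrite Enu; intros En; apply (INR_eq n 1) in En; split.
  + unfold polar_coef; rewrite En; simpl; complex_ring; ring.
  + unfold z3, bessel_coef.
    (* For n = 1 the argument is 4, and Gamma(2) = 1. *)
    replace (rgamma_half (2 * Z.of_nat 0 + s + 2)) with 1
      by (unfold s; rewrite En; change (1 = / ((1 + 1) / 2 * 1)); field).
    replace (2 * INR 0 * x) with 0 by (simpl; ring); rewrite cis_0.
    assert (En1 : nu = 1) by (rewrite Enu, En; reflexivity).
    transitivity (Cscal (- (k / PI)) (Cmul (cis (- tau)) E)).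
    { complex_ring; simpl; field; lra. }
    unfold E; rewrite En1; unfold x; rewrite cis_opp_tau.
    rewrite En1, Rpower_1, En in EW0 by lra; simpl in EW0.
    replace (kappa d) with (c * / 2 / PI) by lra.
    unfold k; rewrite En1, Rpower_Ropp, Rpower_1 by lra.
    complex_ring; field; lra.
- fold nu; rewrite Enu; intros En.
  assert (Hn2 : (2 <= n)%nat) by (destruct n as [|[|]]; [lia|exfalso; apply En; reflexivity|lia]).
  unfold z4, polar_coef; replace (Nat.ltb 1 n) with true by (symmetry; apply Nat.ltb_lt; lia).
  change (INR 1) with 1.
  transitivity (Cscal ((1 - INR n) * (c * Rpower 2 nu / PI * INR (fact (n - 1 - 1)) / 4))
    (Cmul (cis (- tau)) (cis (2 * 1 * x)))).
  { complex_ring; simpl; field; lra. }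
  unfold x; rewrite cis_opp_tau.
  replace (kappa d) with (c * Rpower 2 nu / PI * INR (fact (n - 1)) / 4) by lra.
  replace (n - 1)%nat with (S (n - 1 - 1)) at 2 by lia.
  change (fact (S (n - 1 - 1))) with (S (n - 1 - 1) * fact (n - 1 - 1))%nat.
  rewrite mult_INR; replace (S (n - 1 - 1)) with (n - 1)%nat by lia.
  rewrite minus_INR by exact Hn; simpl INR at 3.
  complex_ring; field; lra.
- intros r y Hr Ht t; fold t in Ht.
  assert (Hq : 0 < sqrt t) by (apply sqrt_lt_R0; lra).
  assert (Hq1 : sqrt t < 1) by (rewrite <- sqrt_1; apply sqrt_lt_1_alt; lra).
  assert (Eq2 : sqrt t ^ 2 = t) by (apply pow2_sqrt; lra).
  rewrite Gl_polar by first [exact Htau | exact Hr | exact (proj1 Ht) | unfold d; lia].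
  fold t x; cbv zeta; fold nu c.
  rewrite (CPSeries_add (N1 * MA) (N2 * MP)) by (try apply cexp_bounded_mul; trivial).
  rewrite (CPSeries_mul MA z1), (CPSeries_mul MP), (CPSeries_mul MA z3), (CPSeries_mul MF) by auto.
  replace (Z.of_nat d - 2)%Z with s by (unfold s, d; lia).
  unfold Hankel1, BesselY.
  assert (Es2 : s = (2 * Z.of_nat n)%Z) by (unfold s; lia).
  replace (Z.even s) with true by (rewrite Es2; now rewrite Z.even_mul).
  replace (Z.to_nat (s / 2)) with n by (rewrite Es2, Z.mul_comm, Z.div_mul by lia; now rewrite Nat2Z.id).
  rewrite (BesselJ_polar s MA), (BesselY_int_polar n MA) by (fold s; auto).
  fold s; replace (nu_of s) with nu
    by (rewrite Enu; unfold nu_of, s; rewrite <- INR_IZR_INZ, mult_INR; simpl; field).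
  rewrite Eq2, <- Enu.
  set (A := CPSeries (bessel_coef s x) t); set (B := CPSeries (polar_coef n x) t).
  set (D := CPSeries (digamma_coef n x) t).
  assert (H1 := Rpower_sqrt_half t nu (proj1 Ht)).
  assert (H2 := Rpower_sqrt_half_opp t nu (proj1 Ht)).
  assert (E1 : E = Cmul (cis (nu * x)) (cis (nu * x))) by (unfold E; rewrite cis_add; f_equal; ring).
  assert (E2 : Cmul (cis (nu * x)) (cis (- nu * x)) = RtoC 1)
    by (rewrite cis_add, <- cis_0; f_equal; ring).
  assert (EL : ln (sqrt t / 2) = / 2 * ln t - ln 2).
  { unfold Rdiv; rewrite ln_mult, ln_Rinv by lra.
    rewrite <- (sqrt_sqrt t) at 2 by lra; rewrite ln_mult by lra; field. }
  rewrite EL.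
  transitivity (Cscal (c * Rpower r nu * Rpower t (- nu)) (Cadd
    (Cscal (Rpower (sqrt t) nu * Rpower (sqrt t / 2) nu) (Cmul (Cmul (cis (nu * x)) (cis (nu * x)))
       (Cadd (Cmul (- (2 / PI) * (/ 2 * ln t - ln 2), 1 - 2 / PI * x) A) (Cscal (/ PI) D))))
    (Cscal (/ PI) (Cscal (Rpower (sqrt t) nu * Rpower (sqrt t / 2) (- nu))
      (Cmul (Cmul (cis (nu * x)) (cis (- nu * x))) B))))).
  { clearbody A B D; generalize (cis (nu * x)) (cis (- nu * x)); intros; complex_ring; field; lra. }
  rewrite E2, <- E1, H1, H2; unfold z1, z2, z3, z4, k; clearbody A B D E.
  rewrite Rpower_Ropp with (x := t).
  generalize (Rpower_pos t nu); intros; complex_ring; field; lra.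
Qed.

(** * Conclusion *)

Lemma exp_bounded_le M N a : M <= N -> exp_bounded M a -> exp_bounded N a.
Proof.
intros HM H m; apply Rle_trans with (1 := H m).
apply Rmult_le_compat_r; [|exact HM].
left; apply Rinv_0_lt_compat, INR_fact_lt_0.
Qed.

(** As ln t and t^(-nu) are real, the rotation can be moved into the coefficients, where
    [profile_symb_2] expects it. *)
Lemma profile_rotation M nu tau U V W t : 0 < t < 1 ->
  cexp_bounded M U -> cexp_bounded M V -> cexp_bounded M W ->
  let re a := fun m : nat => Cre (a m) in
  let im a := fun m : nat => Cim (a m) in
  let rot a := fun m : nat => Cmul (cis (- tau)) (a m) in
  profile nu (re (rot U)) (re (rot V)) (re (rot W)) t =
    cos tau * profile nu (re U) (re V) (re W) t + sin tau * profile nu (im U) (im V) (im W) t /\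
  profile nu (im (rot U)) (im (rot V)) (im (rot W)) t =
    cos tau * profile nu (im U) (im V) (im W) t - sin tau * profile nu (re U) (re V) (re W) t.
Proof.
intros Ht HU HV HW re im rot.
assert (K : forall a, cexp_bounded M a ->
  PSeries (re (rot a)) t = cos tau * PSeries (re a) t + sin tau * PSeries (im a) t /\
  PSeries (im (rot a)) t = cos tau * PSeries (im a) t - sin tau * PSeries (re a) t).
{ intros a Ha; assert (H := CPSeries_mul M (cis (- tau)) a t Ha Ht).
  split; [apply (f_equal Cre) in H|apply (f_equal Cim) in H];
    unfold re, im, rot, Cmul, cis, CPSeries, Cre, Cim in *; simpl in *;
    rewrite H, cos_neg, sin_neg; ring. }
unfold profile.
destruct (K U HU) as [-> ->], (K V HV) as [-> ->], (K W HW) as [-> ->].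
split; ring.
Qed.

Lemma gradDiffNorm_bound d M : (3 <= d)%nat -> 0 <= M ->
  exists K, 0 <= K /\ forall tau, kernel_expansion d M tau ->
  forall r x, 0 < r -> 0 < sqnorm d x -> r * sqnorm d x < 1 ->
  gradDiffNorm d r tau x <= K * r / vnorm d x ^ (d - 3).
Proof.
intros Hd HM; set (nu := order d).
assert (Hnu : 0 < nu) by (generalize (le_INR 3 d Hd); simpl; unfold nu, order; lra).
(* Rotating the coefficients costs a factor 2 in [norm1], hence [2 * M]. *)
destruct (profile_symb_1 (2 * M) nu) as (K1 & S1); [lra|exact Hnu|].
destruct (profile_symb_2 (2 * M) nu) as (K2 & S2); [lra|exact Hnu|].
set (K := Rabs K1 + Rabs K2).
assert (HK1 : K1 <= K) by (generalize (Rle_abs K1) (Rabs_pos K2); unfold K; lra).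
assert (HK2 : K2 <= K) by (generalize (Rle_abs K2) (Rabs_pos K1); unfold K; lra).
exists (sqrt (2 * INR d ^ 3) * (22 * K)); split.
{ apply Rmult_le_pos; [apply sqrt_pos|].
  generalize (Rabs_pos K1) (Rabs_pos K2); unfold K; lra. }
intros tau (U & V & W & (HU & HV & HW) & W0 & HV0 & C1 & C2 & HG) r x Hr Hs Hx; fold nu in HV0, C1, C2, HG.
set (rot := fun (a : nat -> C) m => Cmul (cis (- tau)) (a m)).
assert (Hrot : forall a, cexp_bounded M a -> cexp_bounded (2 * M) (rot a)).
{ intros a Ha; apply cexp_bounded_mul; [apply norm1_cis|exact Ha]. }
assert (Hre : forall a, cexp_bounded M a -> exp_bounded (2 * M) (fun m => Cre (a m))).
{ intros a Ha; apply exp_bounded_le with M; [lra|now apply cexp_bounded_re]. }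
assert (Him : forall a, cexp_bounded M a -> exp_bounded (2 * M) (fun m => Cim (a m))).
{ intros a Ha; apply exp_bounded_le with M; [lra|now apply cexp_bounded_im]. }
assert (Hlog : 1 <= nu \/ (forall m, V m = RtoC 0)).
{ destruct HV0 as [H|[H|H]]; [left; lra|left; lra|now right]. }
set (e := fun t => profile nu (fun m => Cre (U m)) (fun m => Cre (V m)) (fun m => Cre (W m)) t
  - Cre (W 0%nat) * Rpower t (- nu)).
set (f := fun t => profile nu (fun m => Cim (U m)) (fun m => Cim (V m)) (fun m => Cim (W m)) t
  - Cim (W 0%nat) * Rpower t (- nu)).
apply gradDiffNorm_profile with (e := e) (f := f); trivial; fold nu.
- intros y Hy; rewrite HG by trivial.
  rewrite (G0_scaling d r) by (trivial; nra); fold nu.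
  unfold e, f, profile; rewrite W0.
  unfold CPSeries; complex_ring; ring.
- apply symb_le with 1%nat K1 (1 - nu); [lia|exact HK1|lra|].
  apply (S1 (fun m => Cre (U m)) (fun m => Cre (V m)) (fun m => Cre (W m))); auto.
  destruct Hlog as [H|H]; [now left|right; intros m; now rewrite H].
- apply symb_le with 1%nat K1 (1 - nu); [lia|exact HK1|lra|].
  apply (S1 (fun m => Cim (U m)) (fun m => Cim (V m)) (fun m => Cim (W m))); auto.
  destruct Hlog as [H|H]; [now left|right; intros m; now rewrite H].
- apply symb_le with 2%nat K2 (2 - nu); [lia|exact HK2|lra|].
  eapply symb_ext; [|apply (S2 (fun m => Cre (rot U m)) (fun m => Cre (rot V m))
    (fun m => Cre (rot W m)) (kappa d))]; auto using cexp_bounded_re.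
  + intros t Ht; cbv beta; unfold rot.
    rewrite (proj1 (profile_rotation M nu tau U V W t Ht HU HV HW)), W0.
    unfold e, f; rewrite W0.
    unfold cis, Cmul, RtoC, Cre, Cim; simpl; rewrite cos_neg, sin_neg; ring.
  + destruct HV0 as [H|[H|H]]; [now left|right; now left|right; right].
    intros m; unfold rot; rewrite H; unfold Cmul, RtoC, Cre, Cim; simpl; ring.
  + intros E; destruct (C1 E) as [E1 E2]; unfold rot; rewrite E1, E2; split; [|reflexivity].
    unfold Cmul, RtoC, Cre, Cim; simpl; ring.
  + intros E; apply (f_equal Cre) in C2; [|exact E]; revert C2.
    change (Cre (RtoC (kappa d))) with (kappa d); intros <-.
    unfold rot, Cscal, Cre; simpl; ring.
(* In the imaginary part [kappa] is 0: the rotated coefficient is real, so nothing is subtracted. *)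
- apply symb_le with 2%nat K2 (2 - nu); [lia|exact HK2|lra|].
  eapply symb_ext; [|apply (S2 (fun m => Cim (rot U m)) (fun m => Cim (rot V m))
    (fun m => Cim (rot W m)) 0)]; auto using cexp_bounded_im.
  + intros t Ht; cbv beta; unfold rot.
    rewrite (proj2 (profile_rotation M nu tau U V W t Ht HU HV HW)), W0.
    unfold e, f; rewrite W0.
    replace (power_primitive nu 0 t) with 0
      by (unfold power_primitive; destruct (Req_EM_T nu 1); [ring|field; lra]).
    unfold cis, Cmul, RtoC, Cre, Cim; simpl; rewrite cos_neg, sin_neg; ring.
  + destruct HV0 as [H|[H|H]]; [now left|right; now left|right; right].
    intros m; unfold rot; rewrite H; unfold Cmul, RtoC, Cre, Cim; simpl; ring.
  + intros E; destruct (C1 E) as [E1 E2]; unfold rot; rewrite E1, E2; split; [|reflexivity].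
    unfold Cmul, RtoC, Cre, Cim; simpl; ring.
  + intros E; apply (f_equal Cim) in C2; [|exact E]; revert C2.
    change (Cim (RtoC (kappa d))) with 0; intros <-.
    unfold rot, Cscal, Cim; simpl; ring.
Qed.

Lemma kernel_expansion_exists d : (3 <= d)%nat -> exists M, 0 <= M /\
  forall tau, Rabs tau < PI -> kernel_expansion d M tau.
Proof.
intros Hd; destruct (Nat.Even_or_Odd d) as [[n E]|[n E]].
- replace d with (2 * (n - 1) + 2)%nat by lia; apply kernel_expansion_even; lia.
- replace d with (2 * (n - 1) + 3)%nat by lia; apply kernel_expansion_odd.
Qed.

Theorem theorem2p2 :
  forall (d : nat), (3 <= d)%nat ->
  forall theta : R, 0 < theta < PI / 2 ->
  exists Cst : R, 0 < Cst /\
  forall (r tau : R) (x : nat -> R),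
    0 < r -> Rabs tau < PI - theta ->
    vnorm d x <> 0 ->
    r * vnorm d x ^ 2 <= 1 / 2 ->
    gradDiffNorm d r tau x <=
      (if Nat.eqb d 3 then Cst * sqrt r / vnorm d x
       else if (Nat.eqb d 4 || Nat.eqb d 6)%bool then
         Cst * r / vnorm d x ^ (d - 3) * Rabs (ln (r * vnorm d x ^ 2))
       else Cst * r / vnorm d x ^ (d - 3)).
Proof.
intros d Hd theta Htheta.
destruct (kernel_expansion_exists d Hd) as (M & HM & HE).
destruct (gradDiffNorm_bound d M Hd HM) as (K & HK & HB).
(* The factor 2 makes up for a logarithm that may be as small as ln 2 >= 1/2; the 1 keeps the
   constant positive if [K = 0]. *)
exists (2 * K + 1); split; [lra|]; intros r tau x Hr Htau Hx Hrx.
assert (Hv : 0 < vnorm d x) by (generalize (sqrt_pos (Rsum d (fun i => x i ^ 2))); fold (vnorm d x); lra).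
assert (Hs : 0 < sqnorm d x) by (rewrite <- vnorm_sq; now apply pow_lt).
specialize (HB tau (HE tau ltac:(lra)) r x Hr Hs); rewrite <- vnorm_sq in HB.
specialize (HB ltac:(lra)).
assert (Hp : 0 < r / vnorm d x ^ (d - 3)) by (apply Rdiv_lt_0_compat; [exact Hr|now apply pow_lt]).
apply Rle_trans with (1 := HB).
replace (K * r / vnorm d x ^ (d - 3)) with (K * (r / vnorm d x ^ (d - 3))) by (unfold Rdiv; ring).
destruct (Nat.eqb_spec d 3) as [E|E]; [|destruct (Nat.eqb d 4 || Nat.eqb d 6)%bool].
- rewrite E in Hp |- *; rewrite E in Hv, Hrx; simpl pow; rewrite Rdiv_1_r.
  assert (Hq : 0 < sqrt r) by (apply sqrt_lt_R0; exact Hr).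
  (* For d = 3 the bound at hand is K r, and sqrt r |x| <= 1 trades one factor sqrt r for 1 /
     |x|. *)
  assert (Hq2 : sqrt r * vnorm 3 x <= 1).
  { apply Rsqr_incr_0_var; [|lra]; unfold Rsqr.
    replace (sqrt r * vnorm 3 x * (sqrt r * vnorm 3 x)) with (sqrt r * sqrt r * vnorm 3 x ^ 2) by ring.
    rewrite sqrt_sqrt; lra. }
  assert (Hr' : r <= sqrt r / vnorm 3 x).
  { apply Rmult_le_reg_r with (vnorm 3 x); [exact Hv|].
    replace (sqrt r / vnorm 3 x * vnorm 3 x) with (sqrt r) by (field; lra).
    rewrite <- (sqrt_sqrt r) at 1 by lra; nra. }
  replace ((2 * K + 1) * sqrt r / vnorm 3 x) with ((2 * K + 1) * (sqrt r / vnorm 3 x)) by (field; lra).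
  nra.
- assert (Hln : 1 / 2 <= Rabs (ln (r * vnorm d x ^ 2))).
  { assert (0 < r * vnorm d x ^ 2) by (apply Rmult_lt_0_compat; [exact Hr|now apply pow_lt]).
    assert (H2 : ln (r * vnorm d x ^ 2) <= ln (/ 2)) by (apply ln_le; lra).
    rewrite ln_Rinv in H2 by lra; generalize ln_lt_2; intros.
    rewrite Rabs_left; lra. }
  replace ((2 * K + 1) * r / vnorm d x ^ (d - 3) * Rabs (ln (r * vnorm d x ^ 2)))
    with (((2 * K + 1) * Rabs (ln (r * vnorm d x ^ 2))) * (r / vnorm d x ^ (d - 3)))
    by (unfold Rdiv; ring).
  apply Rmult_le_compat_r; [lra|nra].
- replace ((2 * K + 1) * r / vnorm d x ^ (d - 3)) with ((2 * K + 1) * (r / vnorm d x ^ (d - 3)))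
    by (unfold Rdiv; ring).
  apply Rmult_le_compat_r; lra.
Qed.
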